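(* Let $\boldsymbol{\beta}_0\in\mathbb{R}^{d_0}$ and $\sigma^2>0$, and let the test errors $R^{(d)}$ (sequence I) and $R_{(n)}$ (sequence II) be as defined in the context. Under sequence I, as $d\to\infty$ with $d_0$ fixed (and $n=n_0$ fixed), $$R^{(d)}=\sigma^2+\|\boldsymbol{\beta}_0\|^2+O(d^{-1}).$$ Under sequence II, as $n\to\infty$ with $n_0$ fixed (and $d=d_0$ fixed), $$R_{(n)}=\sigma^2+\|\boldsymbol{\beta}_0\|^2+O(n^{-1}).$$
   Context: Data model: $n_0,d_0\ge 1$ are integers; $X$ is an $n_0\times d_0$ random matrix whose rows are independent $N_{d_0}(0,I_{d_0})$; $y=X\boldsymbol{\beta}_0+e$ with $e\sim N_{n_0}(0,\sigma^2I_{n_0})$ independent of $X$. Sequence I (adding predictors, $n=n_0$ fixed): for $d\le d_0$ the training set is $\mathcal{D}^{(d)}=(y,X^{(d)})$, where $X^{(d)}$ contains the first $d$ columns of $X$; for $d>d_0$, $\mathcal{D}^{(d)}=(y,[X,Z])$, where $Z$ is an $n_0\times(d-d_0)$ matrix with independent $N_{d-d_0}(0,I_{d-d_0})$ rows, independent of $X$ and $e$. Sequence II (adding observations, $d=d_0$ fixed): for $n\le n_0$ the training set is $\mathcal{D}_{(n)}=(y_{(n)},X_{(n)})$, where $y_{(n)}$ contains the first $n$ entries of $y$ and $X_{(n)}$ the first $n$ rows of $X$; for $n>n_0$, $\mathcal{D}_{(n)}=([y^T,0_{n-n_0}^T]^T,[X^T,W^T]^T)$, where $W$ is an $(n-n_0)\times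 d_0$ matrix with independent $N_{d_0}(0,I_{d_0})$ rows, independent of $X$ and $e$. Estimators: for a training set $(u,D)$ with response vector $u$ and design matrix $D\in\mathbb{R}^{m\times p}$ (almost surely of full rank), the estimator is the OLS estimator $(D^TD)^{-1}D^Tu$ if $p\le m$ and the minimum norm OLS estimator $D^T(DD^T)^{-1}u$ if $p\ge m$ (they coincide when $p=m$). Applied to $\mathcal{D}^{(d)}$ this gives $\hat{\boldsymbol{\beta}}^{(d)}\in\mathbb{R}^d$; applied to $\mathcal{D}_{(n)}$ it gives $\hat{\boldsymbol{\beta}}_{(n)}\in\mathbb{R}^{d_0}$. Test errors: let $x'\sim N_{d_0}(0,I_{d_0})$ and $y'=x'^T\boldsymbol{\beta}_0+e'$ with $e'\sim N(0,\sigma^2)$, where $x'$ and $e'$ are independent of each other and of the training data. Let $x'^{(d)}$ be the first $d$ elements of $x'$ if $d\le d_0$, and $x'^{(d)}=[x'^T,z'^T]^T$ with $z'\sim N_{d-d_0}(0,I_{d-d_0})$ independent of everything else if $d>d_0$. Then $R^{(d)}=\operatorname{E}\{(y'-x'^{(d)T}\hat{\boldsymbol{\beta}}^{(d)})^2\}$ and $R_{(n)}=\operatorname{E}\{(y'-x'^T\hat{\boldsymbol{\beta}}_{(n)})^2\}$, the expectations being over both the test point and the training data. $\|\cdot\|$ is the Euclidean norm. *)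

(* Defs.v *)
From HB Require Import structures.
From mathcomp Require Import all_boot all_order all_algebra.
From mathcomp Require Import all_classical all_reals all_analysis.
Set Implicit Arguments.
Unset Strict Implicit.
Unset Printing Implicit Defensive.
Import Order.TTheory GRing.Theory Num.Theory.
Import numFieldNormedType.Exports.
Local Open Scope classical_set_scope.
Local Open Scope ring_scope.

Definition sigma_rv (disp : measure_display) (T : measurableType disp)
    (R : realType) (P : probability T R) (Y : {RV P >-> R}) : set (set T) :=
  preimage_set_system setT Y measurable.

(* The sigma-algebra generated by a random matrix (or random vector), i.e. by
   all of its entries; it is trivial when the matrix has no entry. *)
Definition sigma_mx (disp : measure_display) (T : measurableType disp)
    (R : realType) (P : probability T R) (m p : nat)
    (M : 'M[{RV P >-> R}]_(m, p)) : set (set T) :=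
  <<s \bigcup_(ij in [set: 'I_m * 'I_p]) sigma_rv (M ij.1 ij.2) >>.

Definition mutually_independent (disp : measure_display)
    (T : measurableType disp) (R : realType) (P : probability T R)
    (I : finType) (F : I -> set (set T)) : Prop :=
  forall (J : {set I}) (A : I -> set T),
    (forall i, i \in J -> F i (A i)) ->
    P (\bigcap_(i in [set` J]) A i) = (\prod_(i in J) P (A i))%E.

(* N(0, s^2): the second parameter of normal_prob is the standard deviation. *)
Definition has_normal_law (disp : measure_display) (T : measurableType disp)
    (R : realType) (P : probability T R) (s : R) (Y : {RV P >-> R}) : Prop :=
  forall A : set R, measurable A -> distribution P Y A = normal_prob 0 s A.

(* N_p(0, s^2 I_p) *)
Definition is_normal_vector (disp : measure_display) (T : measurableType disp)
    (R : realType) (P : probability T R) (s : R) (p : nat)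
    (v : 'cV[{RV P >-> R}]_p) : Prop :=
  (forall i, has_normal_law s (v i 0)) /\
  mutually_independent P (fun i : 'I_p => sigma_rv (v i 0)).

(* Independent rows, each of them N_p(0, I_p). *)
Definition is_normal_design (disp : measure_display) (T : measurableType disp)
    (R : realType) (P : probability T R) (m p : nat)
    (M : 'M[{RV P >-> R}]_(m, p)) : Prop :=
  (forall i, is_normal_vector 1 (row i M)^T) /\
  mutually_independent P (fun i : 'I_m => sigma_mx (row i M)).

Definition sample (disp : measure_display) (T : measurableType disp)
    (R : realType) (P : probability T R) (m p : nat)
    (M : 'M[{RV P >-> R}]_(m, p)) (w : T) : 'M[R]_(m, p) :=
  map_mx (fun Y : {RV P >-> R} => Y w) M.

Lemma leq_addB (k0 k : nat) : (k <= k0 + (k - k0))%N.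
Proof. by rewrite -leq_subLR. Qed.

(* First k columns of [A, B], where B has k - k0 (truncated) columns: the first
   k columns of A if k <= k0, and the whole of [A, B] if k > k0. *)
Definition extend_cols (R : realType) (m k0 k : nat)
    (A : 'M[R]_(m, k0)) (B : 'M[R]_(m, k - k0)) : 'M[R]_(m, k) :=
  colsub (widen_ord (leq_addB k0 k)) (row_mx A B).

(* The same with rows. *)
Definition extend_rows (R : realType) (p k0 k : nat)
    (A : 'M[R]_(k0, p)) (B : 'M[R]_(k - k0, p)) : 'M[R]_(k, p) :=
  rowsub (widen_ord (leq_addB k0 k)) (col_mx A B).

(* OLS if p <= m, minimum norm OLS otherwise. The matrix inverted is invertible
   iff D has full rank; invmx returns singular matrices unchanged. *)
Definition ols (R : realType) (m p : nat) (u : 'cV[R]_m) (D : 'M[R]_(m, p)) :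
    'cV[R]_p :=
  if (p <= m)%N then invmx (D^T *m D) *m D^T *m u
  else D^T *m invmx (D *m D^T) *m u.

Definition dotv (R : realType) (p : nat) (u v : 'cV[R]_p) : R :=
  (u^T *m v) 0 0.

(* The norm that the library puts on matrices is the sup norm. *)
Definition norm2 (R : realType) (p : nat) (v : 'cV[R]_p) : R :=
  Num.sqrt (\sum_(i < p) v i 0 ^+ 2).

Section TestErrors.
Variables (disp : measure_display) (T : measurableType disp) (R : realType).
Variables (P : probability T R) (n0 d0 : nat) (beta0 : 'cV[R]_d0).
Variables (X : 'M[{RV P >-> R}]_(n0, d0)) (e : 'cV[{RV P >-> R}]_n0).
Variables (x' : 'cV[{RV P >-> R}]_d0) (e' : {RV P >-> R}).

Definition train_response (w : T) : 'cV[R]_n0 :=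
  sample X w *m beta0 + sample e w.

Definition test_response (w : T) : R := dotv (sample x' w) beta0 + e' w.

Definition beta_hat_I (d : nat) (Z : 'M[{RV P >-> R}]_(n0, d - d0)) (w : T) :
    'cV[R]_d :=
  ols (train_response w) (extend_cols (sample X w) (sample Z w)).

Definition test_error_I (d : nat) (Z : 'M[{RV P >-> R}]_(n0, d - d0))
    (z' : 'cV[{RV P >-> R}]_(d - d0)) : \bar R :=
  'E_P[fun w => ((test_response w -
     dotv (extend_rows (sample x' w) (sample z' w)) (beta_hat_I Z w)) ^+ 2)%R]%E.

Definition beta_hat_II (n : nat) (W : 'M[{RV P >-> R}]_(n - n0, d0)) (w : T) :
    'cV[R]_d0 :=
  ols (extend_rows (train_response w) 0 : 'cV[R]_n)
      (extend_rows (sample X w) (sample W w)).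

Definition test_error_II (n : nat) (W : 'M[{RV P >-> R}]_(n - n0, d0)) :
    \bar R :=
  'E_P[fun w => ((test_response w -
     dotv (sample x' w) (beta_hat_II W w)) ^+ 2)%R]%E.

End TestErrors.

(* Main.v *)
Require Import Defs.
From HB Require Import structures.
From mathcomp Require Import all_boot all_order all_algebra.
From mathcomp Require Import all_classical all_reals all_analysis.
From mathcomp Require Import measurable_realfun perm ring lra zify.
Set Implicit Arguments.
Unset Strict Implicit.
Unset Printing Implicit Defensive.
Import Order.TTheory GRing.Theory Num.Theory.
Import numFieldNormedType.Exports.
Local Open Scope classical_set_scope.
Local Open Scope ring_scope.

(** Write [beta] for the true coefficients padded with zeros for the added
    predictors, and [bhat] for the estimator. The test point is independent of
    the training data, centred, with identity covariance, and independent of the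
    test noise; freezing the training data therefore gives
    [R = sigma^2 + E |beta - bhat|^2]. Both claims say that [bhat] becomes
    negligible: [| |beta - bhat|^2 - |beta|^2 |] has expectation [O(1/k)], where
    [k] is the growing dimension.

    Everything that is added enters the Gram matrix as a positive term: it is
    [X X^T + Z Z^T] in the first sequence and [X^T X + W^T W] in the second. If
    [|v|^2 <= c |v Z|^2] for all [v] (resp. the same with [W^T]), then the Gram
    matrix is invertible and the deviation above is at most [c Q], with [Q]
    quadratic in [X] and [e] ([min_norm_bound], [least_squares_bound]). Since
    [c] depends on the added matrix only, [E (c Q) = E c * E Q], and [E Q] does
    not depend on [k]. It remains to find such a [c] with [E c = O(1/k)]
    ([gaussian_lower_bound]), which replaces the exact mean of an inverse
    Wishart matrix.

    The wide Gaussian matrix is cut into square blocks [M], for which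
    [|v|^2 <= (|adj M| / det M)^2 |v M|^2]. This factor has no expectation, but a
    small power of it does: [det M] is affine in each entry, so conditioning on
    all entries but one and using that a normal density is bounded yields, by
    induction on the size, [E |det M|^(-1/2) <= 5^q]
    ([integral_inv_sqrt_det]). Eight independent blocks are combined through the
    product of the eighth roots of their factors ([group_bound]), which has a
    finite expectation by independence. Finally, over [G] disjoint groups of
    eight blocks, the inequality between harmonic and arithmetic means gains the
    factor [1/G] ([harmonic_bound]). *)


(** * Independent sigma-algebras *)

Section IndependentPair.
Context (d : measure_display) (T : measurableType d) (R : realType).
Variable P : probability T R.
Local Open Scope ereal_scope.

Definition independent_classes (F G : set (set T)) :=
  forall A B, F A -> G B -> P (A `&` B) = P A * P B.

Lemma independent_classes_sym F G :
  independent_classes F G -> independent_classes G F.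
Proof. by move=> FG A B GA FB; rewrite setIC FG// muleC. Qed.

Lemma sub_independent_classes F F' G G' : F' `<=` F -> G' `<=` G ->
  independent_classes F G -> independent_classes F' G'.
Proof. by move=> sF sG FG A B /sF FA /sG GB; exact: FG. Qed.

(** For a fixed [B], both sides of the product rule are measures in [A] with the
    same mass, and two such measures that agree on a pi-system agree on the
    sigma-algebra it generates. *)
Lemma independent_sigma_l (F G : set (set T)) :
  F `<=` measurable -> G `<=` measurable ->
  setI_closed F -> F setT ->
  independent_classes F G -> independent_classes <<s F >> G.
Proof.
move=> mF mG FI FT FG A B sFA GB.
have mB : measurable B by exact: mG.
pose m1 := mrestr P mB.
have PBfin : P B \is a fin_num by exact: fin_num_measure.
pose r := NngNum (fine_ge0 (measure_ge0 P B)).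
pose m2 := mscale r P.
have m2E C : m2 C = P B * P C by rewrite /m2 /mscale/= fineK.
rewrite muleC -m2E.
change (m1 A = m2 A).
apply: (g_sigma_algebra_measure_unique F mF (fun=> setT)) => //.
- by apply/seteqP; split => // x _; exists 0%N.
- move=> C FC; transitivity (P (C `&` B)) => //.
  by rewrite FG// -[RHS]/(m2 C) m2E muleC.
- by move=> k; rewrite /m1 /= /mrestr (le_lt_trans (probability_le1 _ _))// ?ltry//; exact: measurableI.
Qed.

Lemma independent_sigma (F G : set (set T)) :
  F `<=` measurable -> G `<=` measurable ->
  setI_closed F -> F setT -> setI_closed G -> G setT ->
  independent_classes F G -> independent_classes <<s F >> <<s G >>.
Proof.
move=> mF mG FI FT GI GT FG.
apply: independent_classes_sym; apply: independent_sigma_l => //.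
  by apply: smallest_sub => //; exact: sigma_algebra_measurable.
by apply: independent_classes_sym; exact: independent_sigma_l.
Qed.

End IndependentPair.

Section Grouping.
Context (d : measure_display) (T : measurableType d) (R : realType).
Variable P : probability T R.
Local Open Scope ereal_scope.

(** A pi-system that generates the join of the classes [F i], [i \in J]. *)
Definition cylinders (I : finType) (F : I -> set (set T)) (J : {set I}) :
  set (set T) :=
  [set C | exists2 A : I -> set T, (forall i, i \in J -> F i (A i)) &
             C = \bigcap_(i in [set` J]) A i].

Lemma cylindersI (I : finType) (F : I -> set (set T)) (J : {set I}) :
  (forall i, setI_closed (F i)) -> setI_closed (cylinders F J).
Proof.
move=> FI _ _ [A FA ->] [B FB ->]; exists (fun i => A i `&` B i).
  by move=> i iJ; apply: FI; [exact: FA|exact: FB].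
by rewrite bigcapI.
Qed.

Lemma cylindersT (I : finType) (F : I -> set (set T)) (J : {set I}) :
  (forall i, F i setT) -> cylinders F J setT.
Proof. by move=> FT; exists (fun=> setT) => //; rewrite bigcapT. Qed.

Lemma cylinders_measurable (I : finType) (F : I -> set (set T)) (J : {set I}) :
  (forall i, F i `<=` measurable) -> cylinders F J `<=` measurable.
Proof.
move=> mF _ [A FA ->]; apply: fin_bigcap_measurable => //.
by move=> i /= iJ; apply: mF; exact: FA.
Qed.

Definition joined (I : finType) (F : I -> set (set T)) (J : {set I}) :=
  \bigcup_(i in [set` J]) F i.

Lemma sub_joined_cylinders (I : finType) (F : I -> set (set T)) (J : {set I}) :
  (forall i, F i setT) -> joined F J `<=` cylinders F J.
Proof.
move=> FT A [i iJ FA]; exists (fun j => if j == i then A else setT).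
  by move=> j _; case: eqP => [->|_]//; exact: FT.
apply/seteqP; split=> [x Ax j _|x /(_ i iJ)]; last by rewrite eqxx.
by case: eqP.
Qed.

(** For cylinders, the product rule over the union of the two groups of indices
    splits into the rules over each group; it then extends to the generated
    sigma-algebras. *)
Lemma independent_joined (I : finType) (F : I -> set (set T)) (J K : {set I}) :
  mutually_independent P F ->
  (forall i, F i `<=` measurable) -> (forall i, setI_closed (F i)) ->
  (forall i, F i setT) -> [disjoint J & K]%B ->
  independent_classes P <<s joined F J >> <<s joined F K >>.
Proof.
move=> iF mF FI FT JK.
have sub L : <<s joined F L >> `<=` <<s cylinders F L >>.
  by apply: sub_sigma_algebra2; exact: sub_joined_cylinders.
apply: (sub_independent_classes (sub J) (sub K)).
apply: independent_sigma; try exact: cylinders_measurable;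
  try exact: cylindersI; try exact: cylindersT.
move=> _ _ [A FA ->] [B FB ->].
pose C i := if i \in J then A i else B i.
have -> : \bigcap_(i in [set` J]) A i `&` \bigcap_(i in [set` K]) B i =
          \bigcap_(i in [set` J :|: K]) C i.
  apply/seteqP; split=> [x [xA xB] i /=|x xC].
    rewrite /C inE; case: ifPn => [iJ _|_ /= iK]; [exact: xA|exact: xB].
  split=> i /= iL.
    by have := xC i; rewrite /= inE iL /C iL; apply.
  have := xC i; rewrite /= inE iL orbT /C.
  by rewrite (disjointFl JK iL); apply.
have FC i : i \in J :|: K -> F i (C i).
  by rewrite inE /C; case: ifPn => [iJ _|_ /= iK]; [exact: FA|exact: FB].
rewrite (iF _ C FC) (iF J A FA) (iF K B FB).
rewrite (eq_bigl [predU J & K]); last by move=> i; rewrite !inE.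
rewrite bigU//=; congr (_ * _); apply: eq_bigr => i iL; rewrite /C ?iL//.
by rewrite (disjointFl JK iL).
Qed.

End Grouping.

(** Measurability for the sigma-algebra generated by [G], which in the sequel is
    a sub-sigma-algebra of the one that the domain carries. *)
Notation measurable_wrt G f :=
  (measurable_fun (setT : set (g_sigma_algebraType G)) f).

Section Decoupling.
Context (d : measure_display) (T : measurableType d) (R : realType).
Variable P : probability T R.
Local Open Scope ereal_scope.

Lemma measurable_wrtW (d' : measure_display) (T' : measurableType d')
    (G : set (set T)) (f : T -> T') :
  G `<=` measurable -> measurable_wrt G f -> measurable_fun setT f.
Proof.
move=> mG mf _ B mB; rewrite setTI.
have := mf measurableT B mB; rewrite setTI => H.
have sG : <<s G >> `<=` @measurable _ T.
  by apply: smallest_sub => //; exact: sigma_algebra_measurable.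
exact: sG.
Qed.

Lemma sub_measurable_wrt (d' : measure_display) (T' : measurableType d')
    (G H : set (set T)) (f : T -> T') :
  G `<=` <<s H >> -> measurable_wrt G f -> measurable_wrt H f.
Proof.
move=> GH mf _ B mB; rewrite setTI.
have := mf measurableT B mB; rewrite setTI => fB.
have sG : <<s G >> `<=` <<s H >>.
  by apply: smallest_sub => //; exact: smallest_sigma_algebra.
exact: sG.
Qed.

End Decoupling.

Lemma eq_measurable_wrt (T : pointedType) (d' : measure_display)
    (T' : measurableType d') (G : set (set T)) (f g : T -> T') :
  f =1 g -> measurable_wrt G f -> measurable_wrt G g.
Proof. by move=> /funext ->. Qed.

Section IndependentPairOfMaps.
Context (d d1 d2 : measure_display) (T : measurableType d).
Context (T1 : measurableType d1) (T2 : measurableType d2) (R : realType).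
Variable P : probability T R.
Variables (U : {mfun T >-> T1}) (V : {mfun T >-> T2}).
Hypothesis indep : forall A B, measurable A -> measurable B ->
  P (U @^-1` A `&` V @^-1` B) = (P (U @^-1` A) * P (V @^-1` B))%E.
Local Open Scope ereal_scope.

Let mUV : measurable_fun setT (fun w : T => (U w, V w)).
Proof. exact: measurable_fun_pair. Qed.

Let UV : {mfun T >-> (T1 * T2)%type} := mfun_Sub (mem_set mUV).

(** Independence is the equality of the joint law with the product of the laws;
    the rest of the section is Tonelli's and Fubini's theorems read through it. *)
Let joint_law (X : set (T1 * T2)) : measurable X ->
  (distribution P U \x distribution P V) X = distribution P UV X.
Proof.
move=> mX; apply: (@product_measure_unique _ _ _ _ _ (distribution P U)
   (distribution P V) (distribution P UV)) => //.
Qed.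

Lemma decoupling (f : T1 * T2 -> \bar R) :
  measurable_fun setT f -> (forall z, 0 <= f z) ->
  \int[P]_w f (U w, V w) = \int[P]_w1 \int[P]_w2 f (U w1, V w2).
Proof.
move=> mf f0.
transitivity (\int[distribution P UV]_z f z).
  by rewrite ge0_integral_distribution.
rewrite (eq_measure_integral (distribution P U \x distribution P V)%E); last first.
  by move=> A mA _; apply: esym; exact: joint_law.
rewrite fubini_tonelli1// /fubini_F ge0_integral_distribution//; last 2 first.
- exact: (measurable_fun_fubini_tonelli_F f).
- by move=> x; exact: integral_ge0.
apply: eq_integral => w1 _ /=.
rewrite ge0_integral_distribution//.
exact: measurableT_comp.
Qed.

Lemma measurable_decoupled (f : T1 * T2 -> \bar R) :
  measurable_fun setT f -> (forall z, 0 <= f z) ->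
  measurable_fun setT (fun w1 => \int[P]_w2 f (U w1, V w2)).
Proof.
move=> mf f0.
rewrite (_ : (fun _ => _) = (fun x => \int[distribution P V]_y f (x, y)) \o U).
  by apply: measurableT_comp => //; exact: (measurable_fun_fubini_tonelli_F f).
apply/funext => w1 /=; rewrite ge0_integral_distribution//.
exact: measurableT_comp.
Qed.

Lemma integralM_indep (f : T1 -> \bar R) (g : T2 -> \bar R) :
  measurable_fun setT f -> measurable_fun setT g ->
  (forall w, 0 <= f w) -> (forall w, 0 <= g w) ->
  \int[P]_w (f (U w) * g (V w)) = \int[P]_w f (U w) * \int[P]_w g (V w).
Proof.
move=> mf mg f0 g0.
transitivity (\int[P]_w1 \int[P]_w2 (f (U w1) * g (V w2))).
  apply: (@decoupling (fun z => f z.1 * g z.2)).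
    by apply: emeasurable_funM; apply: measurableT_comp.
  by move=> z; rewrite mule_ge0.
rewrite -ge0_integralZr//; last exact: integral_ge0.
  apply: eq_integral => w1 _; rewrite ge0_integralZl//.
  exact: measurableT_comp.
exact: measurableT_comp.
Qed.

Lemma integralM_indep_integrable (f : T1 -> R) (g : T2 -> R) :
  measurable_fun setT f -> measurable_fun setT g ->
  P.-integrable setT (EFin \o f \o U) ->
  P.-integrable setT (EFin \o g \o V) ->
  P.-integrable setT (fun w => (f (U w) * g (V w))%:E) /\
  \int[P]_w (f (U w) * g (V w))%:E =
    \int[P]_w (f (U w))%:E * \int[P]_w (g (V w))%:E.
Proof.
move=> mf mg If Ig.
have mfg : measurable_fun setT (fun z : T1 * T2 => (f z.1 * g z.2)%:E).
  by apply/measurable_EFinP; apply: measurable_funM; apply: measurableT_comp.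
have mfg' : measurable_fun setT (fun w : T => (f (U w) * g (V w))%:E).
  exact: (measurableT_comp mfg mUV).
have I : P.-integrable setT (fun w => (f (U w) * g (V w))%:E).
  apply/integrableP; split => //.
  rewrite (eq_integral (fun w => `|(f (U w))%:E| * `|(g (V w))%:E|)); last first.
    by move=> w _; rewrite -abseM.
  rewrite (@integralM_indep (fun w => `|(f w)%:E|) (fun w => `|(g w)%:E|))//.
  - case/integrableP: If => _ If; case/integrableP: Ig => _ Ig.
    by apply: lte_mul_pinfty => //; rewrite ?ge0_fin_numE ?integral_ge0.
  - by apply: measurableT_comp => //; exact/measurable_EFinP.
  - by apply: measurableT_comp => //; exact/measurable_EFinP.
split => //.
transitivity (\int[distribution P UV]_z (f z.1 * g z.2)%:E).
  by rewrite integral_distribution.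
rewrite (eq_measure_integral (distribution P U \x distribution P V)%E); last first.
  by move=> A mA _; apply: esym; exact: joint_law.
have I2 : (distribution P U \x distribution P V)%E.-integrable setT
    (fun z : T1 * T2 => (f z.1 * g z.2)%:E).
  apply/integrableP; split => //.
  rewrite (eq_measure_integral (distribution P UV)).
    rewrite ge0_integral_distribution//; last exact: measurableT_comp.
    by case/integrableP: I.
  by move=> A mA _; exact: joint_law.
rewrite -(integral12_prod_meas1 I2) /fubini_F/=.
transitivity (\int[distribution P U]_x ((f x)%:E * \int[P]_w (g (V w))%:E)).
  apply: eq_integral => w _; rewrite -integralZl//.
  rewrite integral_distribution//=; last exact: (integrableZl measurableT (f w) Ig).
  by apply/measurable_EFinP; exact: measurable_funM.
have gfin : \int[P]_w (g (V w))%:E \is a fin_num by exact: integrable_fin_num.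
rewrite integral_distribution//=.
- by rewrite -(fineK gfin) integralZr.
- by rewrite -(fineK gfin); apply/measurable_EFinP; exact: measurable_funM.
- by rewrite -(fineK gfin); exact: (integrableZr measurableT _ If).
Qed.

End IndependentPairOfMaps.

Section IndependentSigmaAlgebras.
Context (d : measure_display) (T : measurableType d) (R : realType).
Variable P : probability T R.
Variables (G1 G2 : set (set T)).
Hypotheses (mG1 : G1 `<=` measurable) (mG2 : G2 `<=` measurable).
Hypothesis indep : independent_classes P <<s G1 >> <<s G2 >>.
Notation T1 := (g_sigma_algebraType G1).
Notation T2 := (g_sigma_algebraType G2).
Local Open Scope ereal_scope.

Let mid1 : measurable_fun setT (id : T -> T1).
Proof. by apply: (@measurable_wrtW _ _ _ T1 G1 id) => //; exact: measurable_id. Qed.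

Let mid2 : measurable_fun setT (id : T -> T2).
Proof. by apply: (@measurable_wrtW _ _ _ T2 G2 id) => //; exact: measurable_id. Qed.

Let i1 : {mfun T >-> T1} := mfun_Sub (mem_set mid1).
Let i2 : {mfun T >-> T2} := mfun_Sub (mem_set mid2).

(** The decoupling of independent maps, for the identity of [T] seen twice, with
    values in [T] equipped with either of the two sub-sigma-algebras. In this
    form no random element has to be named: the part of an expression that is
    measurable for [G1] and the part that is measurable for [G2] are integrated
    one after the other. *)
Lemma decoupling_sigma (f : T1 * T2 -> \bar R) :
  measurable_fun setT f -> (forall z, 0 <= f z) ->
  \int[P]_w f (w, w) = \int[P]_w1 \int[P]_w2 f (w1, w2).
Proof. by move=> mf f0; rewrite -(@decoupling _ _ _ _ _ _ _ P i1 i2 indep f mf f0). Qed.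

Lemma measurable_decoupled_sigma (f : T1 * T2 -> \bar R) :
  measurable_fun setT f -> (forall z, 0 <= f z) ->
  measurable_fun [set: T] (fun w1 => \int[P]_w2 f (w1, w2)).
Proof. by move=> mf f0; exact: (@measurable_decoupled _ _ _ _ _ _ _ P i1 i2 f mf f0). Qed.

Lemma integralM_indep_sigma (f g : T -> \bar R) :
  measurable_wrt G1 f -> measurable_wrt G2 g ->
  (forall w, 0 <= f w) -> (forall w, 0 <= g w) ->
  \int[P]_w (f w * g w) = \int[P]_w f w * \int[P]_w g w.
Proof.
by move=> mf mg f0 g0;
   rewrite -(@integralM_indep _ _ _ _ _ _ _ P i1 i2 indep f g mf mg f0 g0).
Qed.

End IndependentSigmaAlgebras.

Lemma integral_probability_cst (d : measure_display) (T : measurableType d)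
    (R : realType) (P : probability T R) (c : \bar R) :
  (\int[P]_w c = c)%E.
Proof.
rewrite integral_cst// -[RHS]mule1.
by congr (_ * _)%E; exact: probability_setT.
Qed.

Section RandomVariables.
Context (d : measure_display) (T : measurableType d) (R : realType).
Variable P : probability T R.
Implicit Types X Y : {RV P >-> R}.

Lemma sigma_rv_measurable X : sigma_rv X `<=` measurable.
Proof. by move=> _ [B mB <-]; exact: (measurable_funP X). Qed.

Lemma sigma_rvT X : sigma_rv X setT.
Proof. by exists setT => //; rewrite setTI preimage_setT. Qed.

Lemma sigma_rvI X : setI_closed (sigma_rv X).
Proof.
move=> _ _ [B mB <-] [C mC <-]; exists (B `&` C); first exact: measurableI.
by rewrite !setTI preimage_setI.
Qed.

Lemma measurable_wrt_rv (G : set (set T)) X :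
  sigma_rv X `<=` <<s G >> -> measurable_wrt G X.
Proof. by move=> sG _ B mB; apply: sG; exists B. Qed.

Lemma integralM_indep_rv X Y : independent_classes P (sigma_rv X) (sigma_rv Y) ->
  P.-integrable setT (EFin \o X) -> P.-integrable setT (EFin \o Y) ->
  P.-integrable setT (fun w => (X w * Y w)%:E) /\
  (\int[P]_w (X w * Y w)%:E = \int[P]_w (X w)%:E * \int[P]_w (Y w)%:E)%E.
Proof.
move=> XY IX IY.
apply: (@integralM_indep_integrable _ _ _ _ _ _ _ P X Y _ id id) => //.
by move=> A B mA mB; apply: XY; [exists A|exists B] => //; rewrite setTI.
Qed.

End RandomVariables.

Section ProductsOfIndependent.
Context (d : measure_display) (T : measurableType d) (R : realType).
Variable P : probability T R.
Variables (I : finType) (F : I -> set (set T)).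
Hypothesis indepF : mutually_independent P F.
Hypotheses (mF : forall i, F i `<=` measurable)
  (FI : forall i, setI_closed (F i)) (FT : forall i, F i setT).
Local Open Scope ereal_scope.

Lemma joined_measurable J : joined F J `<=` measurable.
Proof. by move=> A [i iJ FA]; exact: (mF FA). Qed.

Lemma sub_joined (J K : {set I}) : J \subset K -> joined F J `<=` <<s joined F K >>.
Proof.
move=> JK A [i iJ FA]; apply: sub_sigma_algebra; exists i => //=.
exact: (fintype.subsetP JK).
Qed.

(** The product of the factors already treated is measurable for the union of
    their groups of indices, hence independent of the next factor. *)
Lemma integral_prod_indep (K : eqType) (s : seq K) (J : K -> {set I})
    (f : K -> T -> \bar R) :
  uniq s -> (forall j k, j != k -> [disjoint J j & J k]%B) ->
  (forall k, measurable_wrt (joined F (J k)) (f k)) ->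
  (forall k w, 0 <= f k w) ->
  measurable_wrt (joined F (\bigcup_(k <- s) J k)) (fun w => \prod_(k <- s) f k w) /\
  \int[P]_w (\prod_(k <- s) f k w) = \prod_(k <- s) \int[P]_w f k w.
Proof.
move=> + dJ mf f0; elim: s => [_|k s IH /= /andP[ks us]].
  under [X in measurable_wrt _ X]eq_fun do rewrite big_nil.
  under eq_integral do rewrite big_nil.
  split; first exact: measurable_cst.
  by rewrite big_nil integral_probability_cst.
have [mp Ep] := IH us.
have prod0 w : 0 <= \prod_(k <- s) f k w by apply: prode_ge0.
split.
  under [X in measurable_wrt _ X]eq_fun do rewrite big_cons/=.
  rewrite big_cons; apply: emeasurable_funM.
    by apply: sub_measurable_wrt (mf k); apply: sub_joined; exact: finset.subsetUl.
  by apply: sub_measurable_wrt mp; apply: sub_joined; exact: finset.subsetUr.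
under eq_integral do rewrite big_cons/=.
rewrite big_cons/= -Ep.
apply: (@integralM_indep_sigma _ _ _ P (joined F (J k))
  (joined F (\bigcup_(k <- s) J k))) => //.
- exact: joined_measurable.
- exact: joined_measurable.
- apply: independent_joined => //.
  rewrite big_seq; elim/big_rec: _ => [|j A js dA].
    by rewrite finset.disjoints_subset finset.setC0 finset.subsetT.
  rewrite finset.disjoints_subset finset.setCU finset.subsetI -!finset.disjoints_subset dA andbT.
  apply: dJ.
  by apply: contraNneq ks => ->.
Qed.

End ProductsOfIndependent.


(** * Moments of the normal law *)

Section NormalMoments.
Context (R : realType).
Variable s : R.
Hypothesis s0 : 0 < s.
Notation mu := (@lebesgue_measure R).
Notation phi := (normal_pdf 0 s).

Let sn0 : s != 0. Proof. by rewrite gt_eqF. Qed.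

(** The normal law of a set is the integral of the density over it, so the
    density agrees almost everywhere with the Radon-Nikodym derivative. *)
Lemma integral_normal_density (f : R -> \bar R) :
  measurable_fun setT f -> (forall x, 0 <= f x)%E ->
  (\int[normal_prob 0 s]_x f x = \int[mu]_x (f x * (phi x)%:E))%E.
Proof.
move=> mf f0.
have dom := @normal_prob_dominates R 0 s.
rewrite -(Radon_Nikodym_SigmaFinite.change_of_variables dom)//.
set g := Radon_Nikodym_SigmaFinite.f _ _.
have gI := Radon_Nikodym_SigmaFinite.f_integrable dom.
have mphi : measurable_fun setT (EFin \o phi).
  by apply/measurable_EFinP; exact: measurable_normal_pdf.
apply: ae_eq_integral => //.
- by apply: emeasurable_funM => //; exact: measurable_int gI.
- exact: emeasurable_funM.
- apply: ae_eqe_mul2l => /=; apply: integral_ae_eq => //.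
  by move=> E _ mE; rewrite -Radon_Nikodym_SigmaFinite.f_integral.
Qed.

Lemma normal_pdf_sym x : phi (- x) = phi x.
Proof. by rewrite !normal_pdfE//= /normal_fun !subr0 sqrrN. Qed.

(** Its integral over the half-line vanishes, which is the statement that the
    variance is [s ^+ 2]. *)
Lemma is_derive_xphi (x : R) :
  is_derive x 1 (fun x : R => x * phi x) ((1 - x ^+ 2 / s ^+ 2) * phi x).
Proof.
rewrite normal_pdfE// /normal_fun.
apply: is_derive_eq.
rewrite /GRing.scale/= subr0 -mulr_natr; set E := expR _.
by field.
Qed.

Let derivable_xphi x : derivable (fun x : R => x * phi x) x 1.
Proof. by apply: ex_derive; exact: is_derive_xphi. Qed.

Let continuous_xphi : continuous (fun x : R => x * phi x).
Proof.
by move=> x; apply/differentiable_continuous/derivable1_diffP; exact: derivable_xphi.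
Qed.

Lemma cvg_xphi : (- (x * phi x)) @[x --> +oo] --> (0 : R).
Proof.
pose c := normal_peak s * (s ^+ 2 *+ 2).
apply: (@squeeze_cvgr _ _ _ _ (fun x => - (c * x^-1)) (fun=> 0)).
- near=> x; have x0 : 0 < x by near: x; exact: nbhs_pinfty_gt.
  rewrite lerN2 oppr_le0 mulr_ge0 ?normal_pdf_ge0 ?(ltW x0)//= andbT.
  rewrite normal_pdfE// /normal_fun subr0 mulNr expRN.
  set u := x ^+ 2 / _.
  have u0 : 0 < u by rewrite divr_gt0 ?exprn_gt0// pmulrn_lgt0// exprn_gt0.
  rewrite /c -mulrA mulrCA ler_wpM2l ?normal_peak_ge0//.
  rewrite ler_pdivrMr ?expR_gt0//.
  have -> : s ^+ 2 *+ 2 * x^-1 = x * u^-1.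
    rewrite /u -mulr_natr; field.
    by rewrite sn0 gt_eqF.
  rewrite -mulrA ler_peMr ?(ltW x0)// ler_pdivlMl// mulr1.
  by rewrite (le_trans _ (expR_ge1Dx u))// lerDr.
- rewrite -[X in _ --> X]oppr0 -[in X in _ --> X](mulr0 c).
  apply: cvgN; apply: cvgM; first exact: cvg_cst.
  by apply/gtr0_cvgV0; [exact: nbhs_pinfty_gt|exact: cvg_id].
- exact: cvg_cst.
Unshelve. all: by end_near. Qed.


Notation psi := (fun x : R => x ^+ 2 / s ^+ 2 * phi x).

Let psi_ge0 x : 0 <= psi x.
Proof. by rewrite mulr_ge0 ?normal_pdf_ge0// divr_ge0 ?sqr_ge0. Qed.

Let continuous_psi : continuous psi.
Proof.
move=> x; apply: cvgM; last exact: continuous_normal_pdf.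
by apply: cvgM; [exact: exprn_continuous|exact: cvg_cst].
Qed.

Let continuous_dF : continuous (fun x : R => (1 - x ^+ 2 / s ^+ 2) * phi x).
Proof.
move=> x; apply: cvgM; last exact: continuous_normal_pdf.
apply: cvgB; first exact: cvg_cst.
by apply: cvgM; [exact: exprn_continuous|exact: cvg_cst].
Qed.

Let mpsi D : measurable_fun D (EFin \o psi).
Proof. by apply/measurable_EFinP/measurable_funTS; exact: continuous_measurable_fun. Qed.

Let mphi D : measurable_fun D (EFin \o phi).
Proof. by apply/measurable_EFinP/measurable_funTS; exact: measurable_normal_pdf. Qed.

(** The derivative of [x * phi x] changes sign at [s]. Integrating it separately
    over the two intervals keeps all integrands nonnegative, and the boundary
    term [k] appears once on each side. *)
Let k := s * phi s.

Let k0 : 0 <= k. Proof. by rewrite mulr_ge0 ?normal_pdf_ge0// ltW. Qed.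

Local Open Scope ereal_scope.

Let mdF D : measurable_fun D (EFin \o (fun x : R => (1 - x ^+ 2 / s ^+ 2) * phi x)%R).
Proof. by apply/measurable_EFinP/measurable_funTS; exact: continuous_measurable_fun. Qed.

Let tail : \int[mu]_(x in `[s, +oo[) (psi x)%:E =
           \int[mu]_(x in `[s, +oo[) (phi x)%:E + k%:E.
Proof.
have dF_ge0 x : (s <= x -> 0 <= - ((1 - x ^+ 2 / s ^+ 2) * phi x))%R.
  move=> sx; rewrite -mulNr opprB mulr_ge0 ?normal_pdf_ge0// subr_ge0.
  by rewrite -expr_div_n exprn_ege1// ler_pdivlMr// mul1r.
have <- : \int[mu]_(x in `[s, +oo[) (- ((1 - x ^+ 2 / s ^+ 2) * phi x))%:E = k%:E.
  rewrite (@ge0_continuous_FTC2y R _ (fun x => - (x * phi x))%R s 0%R)//.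
  - by rewrite sub0e EFinN oppeK.
  - by apply: continuous_subspaceT => x; apply: cvgN; exact: continuous_dF.
  - exact: cvg_xphi.
  - by move=> x _; apply: derivableN; exact: derivable_xphi.
  - by apply: cvgN; exact/cvg_at_right_filter/continuous_xphi.
  - move=> x _; rewrite derive1E; apply: derive_val.
    by apply: is_deriveN; exact: is_derive_xphi.
rewrite -ge0_integralD//=.
- by apply: eq_integral => x _; rewrite -EFinD; congr EFin; ring.
- by move=> x _; rewrite lee_fin normal_pdf_ge0.
- exact: mphi.
- by move=> x /=; rewrite in_itv/= andbT => sx; rewrite lee_fin dF_ge0.
- by apply/measurable_EFinP; apply: measurable_funN; apply/measurable_EFinP; exact: mdF.
Qed.

Let head : \int[mu]_(x in `[0%R, s]) (phi x)%:E =
           \int[mu]_(x in `[0%R, s]) (psi x)%:E + k%:E.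
Proof.
have <- : \int[mu]_(x in `[0%R, s]) ((1 - x ^+ 2 / s ^+ 2) * phi x)%:E = k%:E.
  rewrite (@continuous_FTC2 R _ (fun x => x * phi x)%R)//.
  - by rewrite mul0r sube0.
  - exact: continuous_subspaceT.
  - split=> //.
    + exact/cvg_at_right_filter/continuous_xphi.
    + exact/cvg_at_left_filter/continuous_xphi.
  - by move=> x _; rewrite derive1E; apply: derive_val; exact: is_derive_xphi.
rewrite -ge0_integralD//=.
- by apply: eq_integral => x _; rewrite -EFinD; congr EFin; ring.
- by move=> x _; rewrite lee_fin psi_ge0.
- exact: mpsi.
- move=> x /=; rewrite in_itv/= => /andP[x0 xs].
  rewrite lee_fin mulr_ge0 ?normal_pdf_ge0// subr_ge0.
  by rewrite -expr_div_n exprn_ile1 ?divr_ge0 ?ler_pdivrMr ?mul1r// ltW.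
- exact: mdF.
Qed.

Let half : \int[mu]_(x in [set x | (0 <= x)%R]) (psi x)%:E =
           \int[mu]_(x in [set x | (0 <= x)%R]) (phi x)%:E.
Proof.
have E : [set x : R | (0 <= x)%R] = `[0%R, s]%classic `|` `]s, +oo[%classic.
  apply/seteqP; split=> x /=; rewrite !in_itv/= andbT.
    by move=> x0; rewrite x0/=; case: (leP x s) => xs; [left|right].
  by move=> [/andP[]//|/ltW]; exact: le_trans (ltW s0).
have D : [disjoint `[0%R, s]%classic & `]s, +oo[%classic].
  apply/disj_set2P/seteqP; split=> x //=; rewrite !in_itv/= andbT.
  by move=> [/andP[_ xs]]; rewrite ltNge xs.
rewrite E !ge0_integral_setU//; first last.
- by move=> x _; rewrite lee_fin psi_ge0.
- exact: mpsi.
- by move=> x _; rewrite lee_fin normal_pdf_ge0.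
- exact: mphi.
rewrite !integral_itv_obnd_cbnd; [|exact: mphi|exact: mpsi].
by rewrite tail head addeAC addeA.
Qed.

Lemma integral_sqr_normal_pdf : \int[mu]_x (x ^+ 2 * phi x)%:E = (s ^+ 2)%:E.
Proof.
transitivity ((s ^+ 2)%:E * \int[mu]_x (psi x)%:E).
  rewrite -ge0_integralZl//=.
  - apply: eq_integral => x _; rewrite -EFinM; congr EFin.
    by rewrite mulrA [(s ^+ 2 * _)%R]mulrC divfK// expf_neq0.
  - exact: mpsi.
  - by move=> x _; rewrite lee_fin psi_ge0.
  - by rewrite lee_fin sqr_ge0.
have -> : \int[mu]_x (psi x)%:E = \int[mu]_x (phi x)%:E.
  rewrite !ge0_symfun_integralT ?half//.
  - by move=> x; exact: normal_pdf_ge0.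
  - exact: continuous_normal_pdf.
  - by move=> x /=; rewrite normal_pdf_sym.
  - by move=> x /=; rewrite normal_pdf_sym sqrrN.
by rewrite integral_normal_pdf mule1.
Qed.

End NormalMoments.


Section NormalVariables.
Context (d : measure_display) (T : measurableType d) (R : realType).
Variables (P : probability T R) (s : R) (Y : {RV P >-> R}).
Hypothesis s0 : 0 < s.
Hypothesis Ys : has_normal_law s Y.
Notation mu := (@lebesgue_measure R).
Notation phi := (normal_pdf 0 s).
Local Open Scope ereal_scope.

Lemma integral_normal_rv (f : R -> \bar R) :
  measurable_fun setT f -> (forall x, 0 <= f x) ->
  \int[P]_w f (Y w) = \int[mu]_x (f x * (phi x)%:E).
Proof.
move=> mf f0; rewrite -(integral_normal_density s)//.
have mY : measurable_fun setT (Y : T -> measurableTypeR R) 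
  by move=> _ A mA; exact: (measurable_funP Y measurableT A mA).
pose Y' : {mfun T >-> measurableTypeR R} :=
  @mfun_Sub _ _ T (measurableTypeR R) Y (mem_set mY).
transitivity (\int[distribution P Y']_x f x).
  by rewrite ge0_integral_distribution.
by apply: eq_measure_integral => A mA _; exact: Ys.
Qed.

Lemma normal_rv_sqr : \int[P]_w (Y w ^+ 2)%:E = (s ^+ 2)%:E.
Proof.
rewrite (@integral_normal_rv (fun x => (x ^+ 2)%:E))/=.
- by rewrite -(integral_sqr_normal_pdf s0); apply: eq_integral => x _; rewrite EFinM.
- by apply/measurable_EFinP; exact: measurable_funX.
- by move=> x; rewrite lee_fin sqr_ge0.
Qed.

Lemma normal_rv_sqr_integrable : P.-integrable setT (fun w => (Y w ^+ 2)%:E).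
Proof.
apply/integrableP; split; first by apply/measurable_EFinP; exact: measurable_funX.
under eq_integral do rewrite /= ger0_norm ?sqr_ge0//.
by rewrite normal_rv_sqr ltry.
Qed.

(** [|y| <= 1 + y ^+ 2]. *)
Lemma normal_rv_integrable : P.-integrable setT (EFin \o Y).
Proof.
have I := integrableD measurableT (finite_measure_integrable_cst P 1%R measurableT)
  normal_rv_sqr_integrable.
apply: le_integrable I => //; first exact/measurable_EFinP.
move=> w _; rewrite /= lee_fin [leRHS]ger0_norm ?addr_ge0 ?sqr_ge0//.
by rewrite -[in leRHS]real_normK ?num_real//; set t := `|_|%R; nra.
Qed.

Lemma integral_normal_rvN (f : R -> \bar R) :
  measurable_fun setT f -> (forall x, 0 <= f x) ->
  \int[P]_w f (- Y w)%R = \int[P]_w f (Y w).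
Proof.
move=> mf f0.
have mN : measurable_fun [set: R] (-%R : R -> R) by exact: oppr_measurable.
rewrite (@integral_normal_rv (fun x => f (- x)%R))//; last exact: measurableT_comp.
rewrite integral_normal_rv//.
pose h x := f x * (phi x)%:E.
have mh : measurable_fun setT h.
  by apply: emeasurable_funM => //; apply/measurable_EFinP; exact: measurable_normal_pdf.
have h0 x : 0 <= h x by rewrite mule_ge0// lee_fin normal_pdf_ge0.
transitivity (\int[mu]_x h (- x)%R).
  by apply: eq_integral => x _; rewrite /h normal_pdf_sym.
transitivity (\int[pushforward mu (-%R : _ -> measurableTypeR R)]_x h x).
  by rewrite ge0_integral_pushforward//= preimage_setT.
by apply: eq_measure_integral => A mA _; exact: lebesgue_measureN.
Qed.

(** By symmetry of the law, the positive and negative parts have the same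
    integral. *)
Lemma normal_rv_mean : \int[P]_w (Y w)%:E = 0.
Proof.
have I := normal_rv_integrable.
rewrite integralE.
have -> : \int[P]_w (fun x => (Y x)%:E)^\- w = \int[P]_w (fun x => (Y x)%:E)^\+ w.
  under eq_integral do rewrite funenegE -EFinN.
  under [RHS]eq_integral do rewrite funeposE.
  apply: (@integral_normal_rvN (fun x => maxe x%:E 0)).
    by apply: measurable_maxe => //; exact/measurable_EFinP.
  by move=> x; rewrite le_max lexx orbT.
rewrite subee// ge0_fin_numE ?integral_ge0//.
by have := integral_funepos_lt_pinfty measurableT I.
Qed.

End NormalVariables.

(** * A negative moment of affine functions of a normal variable *)

Section NegativeMoment.
Context (R : realType).

(** The value at 0 is infinite so that a finite expectation of [inv_sqrt] of a
    random variable forces this variable to be almost surely nonzero. *)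
Definition inv_sqrt (x : R) : \bar R :=
  if x == 0 then +oo%E else ((Num.sqrt `|x|)^-1)%:E.

Lemma inv_sqrt_ge0 x : (0 <= inv_sqrt x)%E.
Proof. by rewrite /inv_sqrt; case: ifP => // _; rewrite lee_fin invr_ge0. Qed.

Lemma inv_sqrtM x y : x != 0 -> inv_sqrt (x * y) = (inv_sqrt x * inv_sqrt y)%E.
Proof.
move=> x0; rewrite /inv_sqrt mulf_eq0 (negbTE x0)/=; case: eqVneq => [_|y0].
  by rewrite gt0_muley// lte_fin invr_gt0 sqrtr_gt0 normr_gt0.
by rewrite normrM sqrtrM// invfM EFinM.
Qed.

Lemma measurable_inv_sqrt : measurable_fun setT inv_sqrt.
Proof.
apply: measurable_fun_ifT => //.
  apply: (measurable_fun_bool true).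
  rewrite (_ : _ @^-1` _ = [set 0]) ?setTI//.
  by apply/seteqP; split => [_ /eqP ->//|_ -> /=]; rewrite eqxx.
apply/measurable_EFinP; under eq_fun do rewrite -powR12_sqrt// -powRN.
by apply: (measurableT_comp (measurable_powR _)) => //; exact: normr_measurable.
Qed.

(** Written [x * (`|x| ^-1) ^+ 2], the inverse is a product of real powers. *)
Lemma measurable_invr : measurable_fun setT (fun x : R => x^-1).
Proof.
have -> : (fun x : R => x^-1) = (fun x => x * (`|x| `^ (-1)) ^+ 2).
  apply/funext => x; have [->|x0] := eqVneq x 0; first by rewrite invr0 mul0r.
  rewrite powR_inv1// exprVn real_normK ?num_real//.
  by rewrite expr2 invfM mulrA divff// mul1r.
apply: measurable_funM => //; apply: measurable_funX.
by apply: (measurableT_comp (measurable_powR _)) => //; exact: normr_measurable.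
Qed.

Definition dyadic_term (k : nat) (x : R) : R :=
  2 ^+ k.+1 * \1_[set y : R | `|y| <= 4^-1 ^+ k] x.

Lemma dyadic_term_ge0 k x : 0 <= dyadic_term k x.
Proof. by rewrite mulr_ge0 ?exprn_ge0. Qed.

(** If [4^-(k+1) < |x| <= 4^-k] then [|x|^(-1/2) < 2^(k+1)]. The sum over all
    scales reduces the expectation of [inv_sqrt] to small-ball probabilities. *)
Lemma inv_sqrt_dyadic (x : R) :
  (inv_sqrt x <= 1 + \sum_(k <oo) (dyadic_term k x)%:E)%E.
Proof.
have t0 k : (0 <= (dyadic_term k x)%:E)%E by rewrite lee_fin dyadic_term_ge0.
have term k : `|x| <= 4^-1 ^+ k ->
    ((2 ^+ k.+1)%:E <= \sum_(k <oo) (dyadic_term k x)%:E)%E.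
  move=> xk.
  apply: (@le_trans _ _ (\sum_(0 <= n < k.+1) (dyadic_term n x)%:E)%E); last first.
    by apply: nneseries_lim_ge => n _ _; exact: t0.
  rewrite big_nat_recr//= -[leLHS]add0e leeD ?sume_ge0//.
  by rewrite /dyadic_term indicE mem_set// mulr1.
rewrite /inv_sqrt; case: eqVneq => [x0|x0].
  suff -> : (\sum_(k <oo) (dyadic_term k x)%:E = +oo)%E by [].
  apply/eqyP => A A0.
  have [n An] : exists n, A <= 2 ^+ n.+1.
    exists (Num.bound A); rewrite (le_trans (ltW (archi_boundP (ltW A0))))//.
    by rewrite -natrX ler_nat (leq_trans _ (ltnW (ltn_expl _ _))).
  apply: (le_trans _ (term n _)); first by rewrite lee_fin.
  by rewrite x0 normr0 exprn_ge0.
have r0 : 0 < `|x| by rewrite normr_gt0.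
have [x1|x1] := leP `|x| 1; last first.
  rewrite -[leLHS]adde0 leeD ?nneseries_ge0// lee_fin invf_le1 ?sqrtr_gt0//.
  by rewrite -sqrtr1 ler_sqrt ltW.
have /ex_minnP[[|k] xk kmin] : exists n, 4^-1 ^+ n < `|x|.
  exists (Num.bound `|x|^-1).
  rewrite exprVn invf_plt ?posrE ?exprn_gt0//.
  rewrite (lt_le_trans (archi_boundP _)) ?invr_ge0//.
  by rewrite -natrX ler_nat ltnW// ltn_expl.
- by move: xk; rewrite expr0 ltNge x1.
have xk' : `|x| <= 4^-1 ^+ k by rewrite leNgt; apply/negP => /kmin; rewrite ltnn.
rewrite -[leLHS]add0e leeD//.
apply: le_trans (term k xk'); rewrite lee_fin invf_ple ?posrE ?sqrtr_gt0 ?exprn_gt0//.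
have -> : 2 ^- k.+1 = Num.sqrt (4^-1 ^+ k.+1) :> R.
  have -> : 4^-1 = 2^-1 ^+ 2 :> R by rewrite exprVn -natrX.
  by rewrite exprAC sqrtr_sqr ger0_norm ?exprn_ge0 ?invr_ge0// exprVn.
by rewrite ler_sqrt ltW.
Qed.

End NegativeMoment.

Section NegativeMomentNormal.
Context (d : measure_display) (T : measurableType d) (R : realType).
Variables (P : probability T R) (Y : {RV P >-> R}).
Hypothesis Y1 : has_normal_law 1 Y.
Notation mu := (@lebesgue_measure R).
Local Open Scope ereal_scope.

(** The density is at most [1/2], because [2 * pi >= 4]. *)
Lemma normal_small_ball (c t : R) : (0 <= t)%R ->
  P [set w | `|Y w + c|%R <= t]%R <= t%:E.
Proof.
move=> t0.
have peak : (normal_peak 1 <= 2^-1 :> R)%R.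
  rewrite /normal_peak lef_pV2 ?posrE ?sqrtr_gt0//; last first.
    by rewrite expr1n mul1r pmulrn_lgt0// pi_gt0.
  rewrite -[leLHS]ger0_norm// -sqrtr_sqr ler_sqrt; last first.
    by rewrite expr1n mul1r pmulrn_lge0// pi_ge0.
  by rewrite expr1n mul1r; have := pi_ge2 R; lra.
have -> : [set w | `|Y w + c|%R <= t]%R = Y @^-1` `[(- c - t)%R, (- c + t)%R]%classic.
  apply/seteqP; split => w /=; rewrite in_itv/= ler_norml.
    by move=> /andP[? ?]; apply/andP; split; lra.
  by move=> /andP[? ?]; apply/andP; split; lra.
have YI : distribution P Y `[(- c - t)%R, (- c + t)%R]%classic = normal_prob 0 1 `[(- c - t)%R, (- c + t)%R]%classic by apply: Y1.
rewrite [leLHS]YI /normal_prob.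
apply: (@le_trans _ _ (\int[mu]_(x in `[(- c - t)%R, (- c + t)%R]%classic) (2^-1)%:E)).
  apply: ge0_le_integral => //.
  - by move=> x _; rewrite lee_fin normal_pdf_ge0.
  - by apply/measurable_EFinP/measurable_funTS; exact: measurable_normal_pdf.
  - by move=> x _; rewrite lee_fin (le_trans _ peak)// normal_pdf_ub.
rewrite integral_cst//= lebesgue_measure_itv/= lte_fin.
case: ifPn => [_|_]; last by rewrite mule0 lee_fin.
by rewrite -EFinD -EFinM lee_fin; lra.
Qed.

Lemma normal_inv_sqrt_shift (c : R) : \int[P]_w inv_sqrt (Y w + c)%R <= 5%:E.
Proof.
have mset k : measurable [set y : R | `|y| <= 4^-1 ^+ k]%R.
  rewrite (_ : [set y | _] = `[(- (4^-1 ^+ k))%R, (4^-1 ^+ k)%R]%classic)//.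
  by apply/seteqP; split=> y /=; rewrite in_itv/= ler_norml.
have mY : measurable_fun setT (fun w => Y w + c)%R by exact: measurable_funD.
have mdyadic k : measurable_fun setT (fun w => (dyadic_term k (Y w + c))%:E).
  apply/measurable_EFinP; apply: measurable_funM => //.
  by apply: measurableT_comp => //; exact: measurable_indic.
have dyadic0 k w : 0 <= (dyadic_term k (Y w + c))%:E.
  by rewrite lee_fin dyadic_term_ge0.
have msum : measurable_fun setT (fun w => \sum_(k <oo) (dyadic_term k (Y w + c))%:E).
  exact: ge0_emeasurable_sum.
apply: (@le_trans _ _
   (\int[P]_w (1 + \sum_(k <oo) (dyadic_term k (Y w + c))%:E))).
  apply: ge0_le_integral => //.
  - by move=> w _; exact: inv_sqrt_ge0.
  - by apply: measurableT_comp => //; exact: measurable_inv_sqrt.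
  - exact: emeasurable_funD.
  - by move=> w _; exact: inv_sqrt_dyadic.
rewrite ge0_integralD//; last by move=> w _; exact: nneseries_ge0.
rewrite integral_probability_cst.
(* 1 comes from the values above 1, and 4 is the sum of 2^(k+1) * 4^-k. *)
have -> : 5%:E = 1 + 4%:E :> \bar R by rewrite -EFinD; congr EFin; ring.
rewrite leeD2l// integral_nneseries//.
have E4 : \sum_(k <oo) (4 / (2 ^ (k + 1))%:R)%:E = 4%:E :> \bar R.
  by have /cvg_lim -> // := @cvg_geometric_eseries_half R 4 0; rewrite expr0 divr1.
rewrite -E4; apply: lee_nneseries => [k _ _|k _]; first exact: integral_ge0.
rewrite /dyadic_term; under eq_integral do rewrite EFinM.
rewrite ge0_integralZl_EFin ?exprn_ge0//; last first.
  by apply/measurable_EFinP; apply: measurableT_comp => //; exact: measurable_indic.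
have -> : \int[P]_w (\1_[set y : R | (`|y| <= 4^-1 ^+ k)%R] (Y w + c)%R)%:E =
    P [set w | `|Y w + c|%R <= 4^-1 ^+ k]%R.
  have mS : measurable [set w | `|Y w + c|%R <= 4^-1 ^+ k]%R.
    by have := mY measurableT _ (mset k); rewrite setTI.
  transitivity (\int[P]_w (\1_[set w | `|Y w + c|%R <= 4^-1 ^+ k]%R w)%:E) => //.
  by rewrite integral_indic// setIT.
apply: (@le_trans _ _ ((2 ^+ k.+1)%:E * (4^-1 ^+ k)%:E)).
  by rewrite lee_pmul2l ?lte_fin ?exprn_gt0// normal_small_ball ?exprn_ge0.
rewrite -EFinM lee_fin addn1 -natrX.
have -> : (4^-1 = 2^-1 ^+ 2 :> R)%R by rewrite exprVn -natrX.
rewrite exprAC !exprVn !natrX exprS; set z := (2 ^+ k)%R.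
have z0 : (z != 0)%R by rewrite expf_neq0.
by rewrite le_eqVlt; apply/orP; left; apply/eqP; field.
Qed.

(** The bound is uniform in [b] and scales with [a], so it applies conditionally
    to random [a] and [b] that are independent of [Y]. *)
Lemma normal_inv_sqrt_affine (a b : R) :
  \int[P]_w inv_sqrt (a * Y w + b)%R <= 5%:E * inv_sqrt a.
Proof.
have [->|a0] := eqVneq a 0%R.
  by rewrite /inv_sqrt eqxx gt0_muley ?leey.
have -> : \int[P]_w inv_sqrt (a * Y w + b)%R =
          \int[P]_w (inv_sqrt a * inv_sqrt (Y w + b / a)%R).
  apply: eq_integral => w _; rewrite -inv_sqrtM//; congr inv_sqrt.
  by rewrite mulrDr mulrCA divff// mulr1.
rewrite ge0_integralZl//.
- by rewrite muleC lee_wpmul2r ?inv_sqrt_ge0// normal_inv_sqrt_shift.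
- by apply: measurableT_comp => //; [exact: measurable_inv_sqrt|exact: measurable_funD].
- by move=> w _; exact: inv_sqrt_ge0.
- exact: inv_sqrt_ge0.
Qed.

End NegativeMomentNormal.


(** * Euclidean bounds for the two estimators *)

Section SquaredNorm.
Context (R : realType).

Definition sqnorm (m n : nat) (A : 'M[R]_(m, n)) : R := \sum_i \sum_j A i j ^+ 2.

Lemma sqnorm_ge0 m n (A : 'M[R]_(m, n)) : 0 <= sqnorm A.
Proof. by rewrite !sumr_ge0// => i _; rewrite sumr_ge0// => j _; exact: sqr_ge0. Qed.

Lemma sqnorm_tr m n (A : 'M[R]_(m, n)) : sqnorm A^T = sqnorm A.
Proof.
rewrite /sqnorm exchange_big; apply: eq_bigr => i _.
by apply: eq_bigr => j _; rewrite mxE.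
Qed.

Lemma sqnorm0 m n : sqnorm (0 : 'M[R]_(m, n)) = 0.
Proof. by rewrite /sqnorm big1// => i _; rewrite big1// => j _; rewrite mxE expr0n. Qed.

Lemma sqnorm_eq0 m n (A : 'M[R]_(m, n)) : sqnorm A = 0 -> A = 0.
Proof.
move=> /psumr_eq0P A0; apply/matrixP => i j; rewrite mxE.
have /psumr_eq0P Ai0 : \sum_j A i j ^+ 2 = 0.
  by apply: A0 => // k _; rewrite sumr_ge0// => l _; exact: sqr_ge0.
by apply/eqP; rewrite -sqrf_eq0 Ai0// => l _; exact: sqr_ge0.
Qed.

Lemma sqnormZ m n a (A : 'M[R]_(m, n)) : sqnorm (a *: A) = a ^+ 2 * sqnorm A.
Proof.
rewrite /sqnorm mulr_sumr; apply: eq_bigr => i _.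
by rewrite mulr_sumr; apply: eq_bigr => j _; rewrite mxE exprMn.
Qed.

Lemma sqnormD_le m n (A B : 'M[R]_(m, n)) :
  sqnorm (A + B) <= 2 * (sqnorm A + sqnorm B).
Proof.
rewrite /sqnorm -big_split/= mulr_sumr ler_sum// => i _.
rewrite -big_split/= mulr_sumr ler_sum// => j _; rewrite mxE.
by rewrite -subr_ge0; have := sqr_ge0 (A i j - B i j); lra.
Qed.

(** From Lagrange's identity. *)
Lemma Cauchy_Schwarz_sum (I : finType) (a b : I -> R) :
  (\sum_i a i * b i) ^+ 2 <= (\sum_i a i ^+ 2) * (\sum_i b i ^+ 2).
Proof.
have : 0 <= \sum_i \sum_j (a i * b j - a j * b i) ^+ 2.
  by rewrite !sumr_ge0// => i _; rewrite sumr_ge0// => j _; exact: sqr_ge0.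
have -> : \sum_i \sum_j (a i * b j - a j * b i) ^+ 2 =
   (\sum_i a i ^+ 2) * (\sum_i b i ^+ 2) *+ 2 - (\sum_i a i * b i) ^+ 2 *+ 2.
  transitivity (\sum_i \sum_j (a i ^+ 2 * b j ^+ 2) +
      \sum_i \sum_j (a j ^+ 2 * b i ^+ 2) -
      (\sum_i \sum_j (a i * b i) * (a j * b j)) *+ 2).
    rewrite -sumrMnl -big_split/= -sumrB; apply: eq_bigr => i _.
    rewrite -sumrMnl -big_split/= -sumrB; apply: eq_bigr => j _.
    by ring.
  rewrite [X in _ + X - _]exchange_big/= -mulr2n; congr (_ *+ 2 - _ *+ 2).
    by rewrite big_distrlr.
  by rewrite expr2 big_distrlr.
by rewrite -mulrnBl pmulrn_lge0// subr_ge0.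
Qed.

Lemma sqnormM_le m n p (A : 'M[R]_(m, n)) (B : 'M[R]_(n, p)) :
  sqnorm (A *m B) <= sqnorm A * sqnorm B.
Proof.
rewrite [X in _ <= _ * X](_ : _ = sqnorm B^T); last by rewrite sqnorm_tr.
rewrite /sqnorm big_distrlr/= ler_sum// => i _; rewrite ler_sum// => j _.
rewrite mxE (le_trans (Cauchy_Schwarz_sum _ _))//.
by rewrite ler_wpM2l ?sumr_ge0// => [k _|]; rewrite ?sqr_ge0// ler_sum// => k _; rewrite mxE.
Qed.

Lemma sqnorm_dot n (u : 'cV[R]_n) : (u^T *m u) 0 0 = sqnorm u.
Proof.
rewrite mxE; apply: eq_bigr => i _.
by rewrite big_ord1 mxE expr2.
Qed.

Lemma sqr_dot_le n (u v : 'cV[R]_n) :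
  (u^T *m v) 0 0 ^+ 2 <= sqnorm u * sqnorm v.
Proof.
have := sqnormM_le u^T v; rewrite sqnorm_tr.
by rewrite {1}/sqnorm big_ord1 big_ord1.
Qed.

Lemma dotE n (u v : 'cV[R]_n) : (u^T *m v) 0 0 = \sum_i u i 0 * v i 0.
Proof. by rewrite mxE; apply: eq_bigr => i _; rewrite mxE. Qed.

Lemma sqnorm_colE n (u : 'cV[R]_n) : sqnorm u = \sum_i u i 0 ^+ 2.
Proof. by apply: eq_bigr => i _; rewrite big_ord1. Qed.

Lemma dotBr n (u v v' : 'cV[R]_n) :
  (u^T *m (v - v')) 0 0 = (u^T *m v) 0 0 - (u^T *m v') 0 0.
Proof. by rewrite !dotE -sumrB; apply: eq_bigr => i _; rewrite !mxE mulrBr. Qed.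

Lemma sqnormB n (u v : 'cV[R]_n) :
  sqnorm (u - v) = sqnorm u - 2 * (u^T *m v) 0 0 + sqnorm v.
Proof.
rewrite dotE !sqnorm_colE mulr_sumr -sumrB -big_split/=.
by apply: eq_bigr => i _; rewrite !mxE; ring.
Qed.

End SquaredNorm.

Section LowerBoundedDesign.
Context (R : realType).

(** For [c > 0], the eigenvalues of [D *m D^T] are then at least [1/c]. *)
Definition bounded_below (c : R) (m p : nat) (D : 'M[R]_(m, p)) :=
  forall v : 'rV[R]_m, sqnorm v <= c * sqnorm (v *m D).

Variables (c : R) (c0 : 0 <= c).

Lemma bounded_below_gram_unit m p (D : 'M[R]_(m, p)) :
  bounded_below c D -> D *m D^T \in unitmx.
Proof.
move=> bD; rewrite -row_free_unit -kermx_eq0; apply/eqP/row_matrixP => i.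
rewrite row0; set v := row i _.
have vG : v *m (D *m D^T) = 0 by rewrite /v -row_mul mulmx_ker row0.
have vD : sqnorm (v *m D) = 0.
  rewrite -[LHS]sqnorm_tr -sqnorm_dot trmxK trmx_mul.
  by rewrite mulmxA -(mulmxA v) vG mul0mx mxE.
apply: sqnorm_eq0; apply/eqP; rewrite eq_le sqnorm_ge0 andbT.
by have := bD v; rewrite vD mulr0.
Qed.

(** The estimator is [D^T w] with [D D^T w = u], so that its squared norm [t]
    equals [w^T u] and its product with [b] equals [(D b)^T w]. Both are
    controlled by the Cauchy-Schwarz inequality and [|w|^2 <= c t]. *)
Lemma min_norm_bound m p (D : 'M[R]_(m, p)) (u : 'cV_m) (b : 'cV_p) :
  bounded_below c D ->
  `|sqnorm (b - D^T *m invmx (D *m D^T) *m u) - sqnorm b| <=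
    c * (2 * sqnorm u + sqnorm (D *m b)).
Proof.
move=> bD; have uG := bounded_below_gram_unit bD.
set w := invmx (D *m D^T) *m u.
have Gw : D *m D^T *m w = u by rewrite /w mulmxA mulmxV// mul1mx.
rewrite -mulmxA -/w; set t := sqnorm (D^T *m w).
have tE : t = (w^T *m u) 0 0.
  by rewrite /t -sqnorm_dot trmx_mul trmxK -{1}Gw !mulmxA.
have wt : sqnorm w <= c * t.
  by have := bD w^T; rewrite sqnorm_tr -(sqnorm_tr (w^T *m D)) trmx_mul trmxK.
have t0 : 0 <= t := sqnorm_ge0 _.
have tu : t <= c * sqnorm u.
  have : t ^+ 2 <= c * t * sqnorm u.
    rewrite {1}tE (le_trans (sqr_dot_le _ _))// ler_wpM2r// sqnorm_ge0//.
  have := sqnorm_ge0 u; move: t0; rewrite le_eqVlt => /predU1P[<- *|t0 u0].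
    by rewrite mulr_ge0.
  by rewrite expr2 mulrAC ler_pM2r.
have cross : (b^T *m (D^T *m w)) 0 0 = ((D *m b)^T *m w) 0 0.
  by rewrite trmx_mul mulmxA.
have cross2 : `|(b^T *m (D^T *m w)) 0 0| * 2 <= c * (sqnorm (D *m b) + sqnorm u).
  have B0 := sqnorm_ge0 (D *m b); have u0 := sqnorm_ge0 u.
  rewrite -ler_sqr ?nnegrE ?mulr_ge0 ?addr_ge0//.
  rewrite exprMn real_normK ?num_real// cross.
  have H1 := sqr_dot_le (D *m b) w.
  have H2 : sqnorm w <= c ^+ 2 * sqnorm u.
    by rewrite expr2 -mulrA (le_trans wt)// ler_wpM2l.
  apply: (@le_trans _ _ (sqnorm (D *m b) * (c ^+ 2 * sqnorm u) * 2 ^+ 2)).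
    by rewrite ler_wpM2r// (le_trans H1)// ler_wpM2l.
  rewrite exprMn -subr_ge0.
  have := sqr_ge0 (sqnorm (D *m b) - sqnorm u); have := sqr_ge0 c.
  by move=> /mulr_ge0/[apply]; congr (0 <= _); ring.
rewrite sqnormB -/t; set X := (b^T *m _) 0 0 in cross2 *.
rewrite (_ : _ - _ = t - 2 * X); last by ring.
by rewrite (le_trans (ler_normB _ _))// ger0_norm// normrM ger0_norm//; lra.
Qed.

(** The fitted vector [D x] is a projection of [u], whence [|x|^2 <= c |u|^2].
    The cross term goes through [|x| <= c |D^T u|], a consequence of the normal
    equations that gives one power of [c] for [|x|] itself; the hypothesis is on
    the square of [F] so that [F] can be chosen quadratic in the data. *)
Lemma least_squares_bound n p (D : 'M[R]_(n, p)) (u : 'cV_n) (b : 'cV_p) (F : R) :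
  bounded_below c D^T -> 0 <= F -> sqnorm (D^T *m u) <= F ^+ 2 ->
  `|sqnorm (b - invmx (D^T *m D) *m D^T *m u) - sqnorm b| <=
    c * (sqnorm u + (1 + sqnorm b) * (2 * F)).
Proof.
move=> bD F0 HF; have := bounded_below_gram_unit bD; rewrite trmxK => uG.
rewrite -mulmxA; set r := D^T *m u in HF *; set x := invmx _ *m r.
have Gx : D^T *m D *m x = r by rewrite /x mulmxA mulmxV// mul1mx.
set t := sqnorm (D *m x).
have tE : t = (x^T *m r) 0 0 by rewrite /t -sqnorm_dot trmx_mul -Gx !mulmxA.
have xt : sqnorm x <= c * t.
  by have := bD x^T; rewrite sqnorm_tr -(sqnorm_tr (x^T *m _)) trmx_mul !trmxK.
have t0 : 0 <= t := sqnorm_ge0 _.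
have x0 : 0 <= sqnorm x := sqnorm_ge0 _.
have tu : t <= sqnorm u.
  have : t ^+ 2 <= t * sqnorm u.
    rewrite {1}tE /r mulmxA -trmx_mul; exact: sqr_dot_le.
  move: t0; rewrite le_eqVlt => /predU1P[<- _|t0]; first exact: sqnorm_ge0.
  by rewrite expr2 ler_pM2l.
have xF : sqnorm x <= c ^+ 2 * F ^+ 2.
  have : sqnorm x ^+ 2 <= c ^+ 2 * (sqnorm x * F ^+ 2).
    apply: (@le_trans _ _ ((c * t) ^+ 2)); first by rewrite ler_sqr ?nnegrE// mulr_ge0.
    rewrite exprMn ler_wpM2l ?sqr_ge0// tE (le_trans (sqr_dot_le _ _))//.
    by rewrite ler_wpM2l.
  move: x0; rewrite le_eqVlt => /predU1P[<- _|x0]; first by rewrite mulr_ge0 ?sqr_ge0.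
  by rewrite expr2 mulrCA ler_pM2l.
have b0 := sqnorm_ge0 b.
have cross2 : `|(b^T *m x) 0 0| <= c * ((1 + sqnorm b) * F).
  rewrite -ler_sqr ?nnegrE ?mulr_ge0 ?addr_ge0//.
  rewrite real_normK ?num_real// (le_trans (sqr_dot_le _ _))//.
  apply: (@le_trans _ _ (sqnorm b * (c ^+ 2 * F ^+ 2))); first by rewrite ler_wpM2l.
  rewrite -subr_ge0 (_ : _ - _ = (c * F) ^+ 2 * ((1 + sqnorm b) ^+ 2 - sqnorm b)); last by ring.
  by rewrite mulr_ge0 ?sqr_ge0//; nra.
rewrite sqnormB; set X := (b^T *m _) 0 0 in cross2 *.
rewrite (_ : _ - sqnorm b = sqnorm x - 2 * X); last by ring.
rewrite (le_trans (ler_normB _ _))// ger0_norm// normrM ger0_norm//.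
have := ler_wpM2l c0 tu; lra.
Qed.

End LowerBoundedDesign.

(** * Combining square blocks *)

Section SquareBlocks.
Context (R : realType).

(** Its eighth power dominates [(|adj M| / det M)^2], but it involves [det M] only
    through [|det M|^(-1/2)], which has a finite mean for Gaussian blocks. *)
Definition block_weight (q : nat) (M : 'M[R]_q) : R :=
  1 + sqnorm (\adj M) + (Num.sqrt `|\det M|)^-1.

Lemma block_weight_ge1 q (M : 'M[R]_q) : 1 <= block_weight M.
Proof. by rewrite /block_weight -addrA lerDl addr_ge0 ?sqnorm_ge0 ?invr_ge0. Qed.

(** From [det M *: v = v *m M *m \adj M]. With [r] the square root of [|det M|],
    the factor to dominate is [|adj M|^2 * r^-4], and each of its two terms is at
    most the fourth power of the weight. *)
Lemma block_weight_bound q (M : 'M[R]_q) (v : 'rV_q) : \det M != 0 ->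
  sqnorm v <= block_weight M ^+ 8 * sqnorm (v *m M).
Proof.
move=> dM0.
have H : \det M ^+ 2 * sqnorm v <= sqnorm (v *m M) * sqnorm (\adj M).
  rewrite -sqnormZ; have -> : \det M *: v = v *m M *m \adj M.
    by rewrite -mulmxA mul_mx_adj mul_mx_scalar.
  exact: sqnormM_le.
have A0 := sqnorm_ge0 (\adj M); have N0 := sqnorm_ge0 (v *m M).
rewrite /block_weight; set A := sqnorm (\adj M) in A0 H *; set N := sqnorm (v *m M) in N0 H *.
set r := Num.sqrt _.
have r0 : 0 < r by rewrite sqrtr_gt0 normr_gt0.
have r4 : r ^+ 4 = \det M ^+ 2.
  by rewrite (exprM r 2 2) sqr_sqrtr// real_normK ?num_real.
have ri : r^-1 ^+ 4 * \det M ^+ 2 = 1 by rewrite -r4 -exprMn mulVf ?gt_eqF// expr1n.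
have H2 : sqnorm v <= r^-1 ^+ 4 * (N * A).
  by rewrite -[leLHS]mul1r -ri -mulrA ler_wpM2l// exprn_ge0// invr_ge0 ltW.
apply: (le_trans H2); rewrite mulrCA [leRHS]mulrC ler_wpM2l//.
have ri0 : 0 <= r^-1 by rewrite invr_ge0 ltW.
rewrite (exprD _ 4 4) ler_pM ?exprn_ge0//.
  by rewrite lerXn2r ?nnegrE ?addr_ge0// lerDr addr_ge0.
rewrite (@le_trans _ _ (1 + A + r^-1))//; first lra.
by rewrite ler_eXnr//; lra.
Qed.

(** Multiply the [n.+1] inequalities and take a root. The power of each weight is
    thereby spread over the factors of a product, whose expectation only
    requires first moments when the weights are independent. *)
Lemma group_bound (n : nat) (K : finType) (w : K -> R) (N : K -> R) (x : R) :
  #|K| = n.+1 -> 0 <= x -> (forall k, 0 <= w k) -> (forall k, 0 <= N k) ->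
  (forall k, x <= w k ^+ n.+1 * N k) ->
  x <= (\prod_k w k) * \sum_k N k.
Proof.
move=> Kn x0 w0 N0 wN.
have S0 : 0 <= \sum_k N k by rewrite sumr_ge0.
rewrite -(@ler_pXn2r _ n.+1) ?nnegrE ?mulr_ge0 ?prodr_ge0//.
rewrite exprMn -{1 3}Kn -prodrXl -!prodr_const -big_split/=.
apply: ler_prod => k _; rewrite x0/= (le_trans (wN k))// ler_wpM2l ?exprn_ge0//.
by rewrite (bigD1 k)//= lerDl sumr_ge0.
Qed.

(** The harmonic mean is at most the arithmetic mean. This is the step that makes
    the final bound decay with the number of groups. *)
Lemma harmonic_bound (G : nat) (r N : 'I_G -> R) (x : R) :
  0 <= x -> (forall g, 0 <= r g) -> (forall g, 0 <= N g) ->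
  (forall g, x <= r g * N g) ->
  G%:R ^+ 2 * x <= (\sum_g r g) * \sum_g N g.
Proof.
move=> x0 r0 N0 rN.
have E : \sum_(i < G) \sum_(j < G) (r i * N j + r j * N i) =
  ((\sum_g r g) * \sum_g N g) *+ 2.
  under eq_bigr do rewrite big_split/=.
  rewrite big_split/= [X in _ + X]exchange_big/= -mulr2n.
  by rewrite big_distrlr.
have : \sum_(i < G) \sum_(j < G) (x *+ 2) <= ((\sum_g r g) * \sum_g N g) *+ 2.
  rewrite -E ler_sum// => i _; rewrite ler_sum// => j _.
  rewrite -(@ler_sqr _ (x *+ 2)) ?nnegrE ?mulrn_wge0 ?addr_ge0 ?mulr_ge0//.
  (* The two terms have a product at least x ^+ 2, so their sum is at least 2 x. *)
  have H : x ^+ 2 <= (r i * N j) * (r j * N i).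
    by rewrite expr2 mulrACA (mulrC (N j)) mulrACA ler_pM//.
  rewrite -subr_ge0.
  have := sqr_ge0 (r i * N j - r j * N i); set a := r i * N j in H *; set b := r j * N i in H *.
  by rewrite -mulr_natl; nra.
have -> : \sum_(i < G) \sum_(j < G) (x *+ 2) = (G%:R ^+ 2 * x) *+ 2.
  by rewrite !sumr_const card_ord -[LHS]mulr_natr -[X in X * _]mulr_natr; ring.
by rewrite lerMn2r.
Qed.

End SquareBlocks.


(** * Determinants of Gaussian matrices *)

Section MeasurableMatrices.
Context (d : measure_display) (S : measurableType d) (R : realType).

Definition measurable_mx (m n : nat) (A : S -> 'M[R]_(m, n)) :=
  forall i j, measurable_fun setT (fun w => A w i j).

Lemma measurable_mulmx m n p (A : S -> 'M[R]_(m, n)) (B : S -> 'M[R]_(n, p)) :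
  measurable_mx A -> measurable_mx B -> measurable_mx (fun w => A w *m B w).
Proof.
move=> mA mB i j; under eq_fun do rewrite mxE.
by apply: measurable_sum => k; apply: measurable_funM.
Qed.

Lemma measurable_trmx m n (A : S -> 'M[R]_(m, n)) :
  measurable_mx A -> measurable_mx (fun w => (A w)^T).
Proof. by move=> mA i j; under eq_fun do rewrite mxE; exact: mA. Qed.

Lemma measurable_addmx m n (A B : S -> 'M[R]_(m, n)) :
  measurable_mx A -> measurable_mx B -> measurable_mx (fun w => A w + B w).
Proof.
by move=> mA mB i j; under eq_fun do rewrite mxE; exact: measurable_funD.
Qed.

Lemma measurable_det n (A : S -> 'M[R]_n) :
  measurable_mx A -> measurable_fun setT (fun w => \det (A w)).
Proof.
move=> mA; apply: measurable_sum => s; apply: measurable_funM => //.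
by apply: measurable_prod => i _; exact: mA.
Qed.

(** Row [i] is left out of the hypothesis: the cofactors along a row are
    measurable for the sigma-algebra of the other rows. *)
Lemma measurable_cofactor n (A : S -> 'M[R]_n) i j :
  (forall k l, k != i -> measurable_fun setT (fun w => A w k l)) ->
  measurable_fun setT (fun w => cofactor (A w) i j).
Proof.
move=> mA; apply: measurable_funM => //; apply: measurable_det => k l.
by under eq_fun do rewrite !mxE; apply: mA; rewrite eq_sym neq_lift.
Qed.

Lemma measurable_adj n (A : S -> 'M[R]_n) :
  measurable_mx A -> measurable_mx (fun w => \adj (A w)).
Proof.
move=> mA i j; under eq_fun do rewrite mxE.
by apply: measurable_cofactor => k l _; exact: mA.
Qed.

Lemma measurable_sqnorm m n (A : S -> 'M[R]_(m, n)) :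
  measurable_mx A -> measurable_fun setT (fun w => sqnorm (A w)).
Proof.
move=> mA; apply: measurable_sum => i; apply: measurable_sum => j.
exact: measurable_funX.
Qed.

Lemma measurable_invmx n (A : S -> 'M[R]_n) :
  measurable_mx A -> measurable_mx (fun w => invmx (A w)).
Proof.
move=> mA i j.
have -> : (fun w => invmx (A w) i j) =
  (fun w => if \det (A w) == 0 then A w i j else (\det (A w))^-1 * \adj (A w) i j).
  apply/funext => w; rewrite /invmx unitmxE unitfE.
  by case: eqVneq => //= _; rewrite mxE.
have mdet := measurable_det mA.
apply: measurable_fun_ifT.
- by apply: measurable_fun_eqr.
- exact: mA.
- apply: measurable_funM; last exact: measurable_adj.
  by apply: measurableT_comp mdet => //; exact: measurable_invr.
Qed.

End MeasurableMatrices.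

Section GaussianBlocks.
Context (d : measure_display) (T : measurableType d) (R : realType).
Variable P : probability T R.
Variables (I : finType) (Y : I -> {RV P >-> R}).
Hypothesis Y1 : forall i, has_normal_law 1 (Y i).
Hypothesis indepY : mutually_independent P (fun i => sigma_rv (Y i)).
Notation F := (fun i => sigma_rv (Y i)).
Local Open Scope ereal_scope.

Let mF i : F i `<=` measurable := @sigma_rv_measurable _ _ _ _ (Y i).
Let FI i : setI_closed (F i) := @sigma_rvI _ _ _ _ (Y i).
Let FT i : F i setT := @sigma_rvT _ _ _ _ (Y i).

Lemma measurable_joined (J : {set I}) i : i \in J -> measurable_wrt (joined F J) (Y i).
Proof.
move=> iJ; apply: measurable_wrt_rv => A YA; apply: sub_sigma_algebra.
by exists i.
Qed.

Definition block (m n : nat) (h : 'I_m -> 'I_n -> I) (w : T) : 'M[R]_(m, n) :=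
  \matrix_(i, j) Y (h i j) w.

Lemma blockE m n (h : 'I_m -> 'I_n -> I) w i j : block h w i j = Y (h i j) w.
Proof. by rewrite mxE. Qed.

Definition block_index (m n : nat) (h : 'I_m -> 'I_n -> I) : {set I} :=
  [set h ij.1 ij.2 | ij : 'I_m * 'I_n]%SET.

(** The entries of [block h] are then distinct members of [Y], hence mutually
    independent. *)
Definition injective_index (m n : nat) (h : 'I_m -> 'I_n -> I) :=
  injective (fun ij : 'I_m * 'I_n => h ij.1 ij.2).

Lemma measurable_block m n (h : 'I_m -> 'I_n -> I) (J : {set I}) :
  block_index h \subset J ->
  @measurable_mx _ (g_sigma_algebraType (joined F J)) R m n (block h).
Proof.
move=> hJ i j; apply: (@eq_measurable_wrt _ _ _ _ (Y (h i j))) => [w|].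
  by rewrite blockE.
apply: measurable_joined; apply: (fintype.subsetP hJ).
by apply/imsetP; exists (i, j).
Qed.

Lemma sub_injective_index m n m' n' (h : 'I_m -> 'I_n -> I)
    (f : 'I_m' -> 'I_m) (g : 'I_n' -> 'I_n) :
  injective f -> injective g -> injective_index h ->
  injective_index (fun i j => h (f i) (g j)).
Proof.
move=> fI gI hI [i j] [k l] /= E.
by have [/fI -> /gI ->] := hI (f i, g j) (f k, g l) E.
Qed.

(** The determinant is affine in its top left entry, with the complementary minor
    as slope, and this entry is independent of the slope and of the constant
    term. Integrating it first costs a factor 5 and leaves the minor, to which
    the induction hypothesis applies. *)
Lemma integral_inv_sqrt_det q (h : 'I_q -> 'I_q -> I) : injective_index h ->
  \int[P]_w inv_sqrt (\det (block h w)) <= (5 ^+ q)%:E.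
Proof.
elim: q h => [|q IH] h hI.
  under eq_integral do rewrite det_mx00.
  by rewrite integral_probability_cst /inv_sqrt oner_eq0 normr1 sqrtr1 invr1.
pose h' i j := h (lift 0%R i) (lift 0%R j).
have hI' : injective_index h' by apply: sub_injective_index hI; exact: lift_inj.
pose a w : R := \det (block h' w).
pose b w : R := (\sum_(j < q) block h w 0 (lift 0 j) * cofactor (block h w) 0 (lift 0 j))%R.
have detE w : \det (block h w) = (a w * Y (h 0%R 0%R) w + b w)%R.
  rewrite (expand_det_row _ 0%R) big_ord_recl; congr (_ + _)%R.
  rewrite blockE mulrC /cofactor addn0 expr0 mul1r; congr (\det _ * _)%R.
  by apply/matrixP => i j; rewrite !mxE.
pose J1 : {set I} := (~: [set h 0%R 0%R])%SET; pose J2 : {set I} := [set h 0%R 0%R]%SET.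
have hJ1 i j : (i, j) != (0%R, 0%R) -> h i j \in J1.
  by move=> ij; rewrite !inE; apply: contra_neq ij => /(hI (i, j) (0%R, 0%R)).
have ma : measurable_wrt (joined F J1) a.
  apply: measurable_det => i j; apply: (@eq_measurable_wrt _ _ _ _ (Y (h' i j))) => [w|].
    by rewrite blockE.
  by apply: measurable_joined; exact: hJ1.
have mb : measurable_wrt (joined F J1) b.
  apply: measurable_sum => j; apply: measurable_funM.
    apply: (@eq_measurable_wrt _ _ _ _ (Y (h 0%R (lift 0%R j)))) => [w|].
      by rewrite blockE.
    by apply: measurable_joined; exact: hJ1.
  apply: measurable_cofactor => k l k0.
  apply: (@eq_measurable_wrt _ _ _ _ (Y (h k l))) => [w|]; first by rewrite blockE.
  by apply: measurable_joined; apply: hJ1; apply: contra_neq k0 => -[].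
have mY : measurable_wrt (joined F J2) (Y (h 0%R 0%R)).
  by apply: measurable_joined; rewrite inE.
have indep : independent_classes P <<s joined F J1 >> <<s joined F J2 >>.
  apply: independent_joined => //.
  by rewrite finset.disjoints_subset finset.setCS.
under eq_integral do rewrite detE.
pose f (z : g_sigma_algebraType (joined F J1) * g_sigma_algebraType (joined F J2)) :=
  inv_sqrt (a z.1 * Y (h 0%R 0%R) z.2 + b z.1)%R.
have f0 z : 0 <= f z by exact: inv_sqrt_ge0.
have mf : measurable_fun setT f.
  apply: measurableT_comp; first exact: measurable_inv_sqrt.
  apply: measurable_funD; last exact: measurableT_comp mb measurable_fst.
  apply: measurable_funM; first exact: measurableT_comp ma measurable_fst.
  exact: measurableT_comp mY measurable_snd.
have mJ J : joined F J `<=` measurable by exact: joined_measurable.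
rewrite (decoupling_sigma (mJ J1) (mJ J2) indep mf f0).
have ma' : measurable_fun setT a.
  by apply: measurable_wrtW ma; exact: joined_measurable.
have mia : measurable_fun setT (fun w => inv_sqrt (a w)).
  by apply: measurableT_comp => //; exact: measurable_inv_sqrt.
apply: (@le_trans _ _ (\int[P]_w (5%:E * inv_sqrt (a w)))).
  apply: ge0_le_integral => //.
  - by move=> w _; apply: integral_ge0 => v _; exact: inv_sqrt_ge0.
  - exact: (measurable_decoupled_sigma P (mJ J1) (mJ J2) mf f0).
  - exact: measurable_funeM.
  - by move=> w _; exact: (normal_inv_sqrt_affine (Y1 (h 0%R 0%R)) (a w) (b w)).
rewrite ge0_integralZl//; last by move=> w _; exact: inv_sqrt_ge0.
by rewrite exprS EFinM lee_pmul2l// IH.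
Qed.

End GaussianBlocks.


(** A crude bound, whose right-hand side has the merit of being a product over
    the entries: its moments factor when the entries are independent. *)
Lemma det_le_prod (R : realType) (q : nat) (B : 'M[R]_q) :
  `|\det B| <= q`!%:R * \prod_(ij : 'I_q * 'I_q) (1 + `|B ij.1 ij.2|).
Proof.
rewrite (le_trans (ler_norm_sum _ _ _))//.
have -> : q`!%:R * \prod_(ij : 'I_q * 'I_q) (1 + `|B ij.1 ij.2|) =
    \sum_(s : 'S_q) \prod_(ij : 'I_q * 'I_q) (1 + `|B ij.1 ij.2|).
  by rewrite sumr_const card_Sn mulr_natl.
rewrite ler_sum// => s _; rewrite normrM normrX normrN1 expr1n mul1r normr_prod.
rewrite -(pair_bigA _ (fun i j => 1 + `|B i j|))/=.
apply: ler_prod => i _; rewrite normr_ge0/= (bigD1 (s i))//=.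
rewrite -[leLHS]mulr1 ler_pM//; first by rewrite lerDr.
elim/big_rec: _ => // j x _ x1.
by rewrite -[leLHS]mulr1 ler_pM// lerDl.
Qed.

Section GaussianKey.
Context (d : measure_display) (T : measurableType d) (R : realType).
Variable P : probability T R.
Variables (I : finType) (Y : I -> {RV P >-> R}).
Hypothesis Y1 : forall i, has_normal_law 1 (Y i).
Hypothesis indepY : mutually_independent P (fun i => sigma_rv (Y i)).
Notation F := (fun i => sigma_rv (Y i)).
Local Open Scope ereal_scope.

Let mF i : F i `<=` measurable := @sigma_rv_measurable _ _ _ _ (Y i).
Let FI i : setI_closed (F i) := @sigma_rvI _ _ _ _ (Y i).
Let FT i : F i setT := @sigma_rvT _ _ _ _ (Y i).
Let mJ J : joined F J `<=` measurable. Proof. exact: joined_measurable. Qed.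

(** 4 is an upper bound for the mean of [(1 + |y|) ^+ 2], which is at most
    [2 + 2 * y ^+ 2]. *)
Definition det_sqr_bound (q : nat) : R := (q`!%:R ^+ 2 * 4 ^+ (q * q))%R.

Lemma integral_det_sqr q (h : 'I_q -> 'I_q -> I) : injective_index h ->
  \int[P]_w (\det (block Y h w) ^+ 2)%:E <= (det_sqr_bound q)%:E.
Proof.
move=> hI.
pose f (ij : 'I_q * 'I_q) w := ((1 + `|Y (h ij.1 ij.2) w|) ^+ 2)%:E.
have f0 ij w : 0 <= f ij w by rewrite lee_fin sqr_ge0.
have mf ij : measurable_wrt (joined F [set h ij.1 ij.2]%SET) (f ij).
  apply/measurable_EFinP; apply: measurable_funX; apply: measurable_funD => //.
  apply: measurableT_comp => //; apply: measurable_joined; exact: set11.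
have dJ (j k : 'I_q * 'I_q) : j != k ->
    [disjoint [set h j.1 j.2]%SET & [set h k.1 k.2]%SET]%B.
  by move=> jk; rewrite disjoints1 inE; apply: contra_neq jk; exact: hI.
have [_ Ef] := integral_prod_indep indepY mF FI FT
  (index_enum_uniq ('I_q * 'I_q)%type) dJ mf f0.
have mdet : measurable_fun setT (fun w => \det (block Y h w)).
  apply: measurable_wrtW (mJ (J := [set: I]%SET)) _; apply: measurable_det.
  by apply: measurable_block; exact: finset.subsetT.
have mprod : measurable_fun setT (fun w => \prod_(ij : 'I_q * 'I_q) f ij w).
  under eq_fun do rewrite prodEFin.
  apply/measurable_EFinP/measurable_prod => ij _.
  by apply: measurable_funX; apply: measurable_funD => //; exact: measurableT_comp.
apply: (@le_trans _ _ (\int[P]_w ((q`!%:R ^+ 2)%:E * \prod_ij f ij w))).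
  apply: ge0_le_integral => //.
  - by move=> w _; rewrite lee_fin sqr_ge0.
  - by apply/measurable_EFinP; exact: measurable_funX.
  - exact: measurable_funeM.
  - move=> w _; rewrite prodEFin -EFinM lee_fin prodrXl -exprMn.
    rewrite -[leLHS]real_normK ?num_real// lerXn2r ?nnegrE//.
      by rewrite mulr_ge0// prodr_ge0// => ij _; rewrite addr_ge0.
    rewrite (le_trans (det_le_prod _))// le_eqVlt; apply/orP; left; apply/eqP.
    by congr (_ * _)%R; apply: eq_bigr => ij _; rewrite blockE.
rewrite ge0_integralZl//; first last.
- by move=> w _; apply: prode_ge0.
rewrite Ef /det_sqr_bound [leRHS]EFinM lee_wpmul2l ?lee_fin ?sqr_ge0//.
have E4 ij : \int[P]_w f ij w <= 4%:E.
  have I2 := normal_rv_sqr ltr01 (Y1 (h ij.1 ij.2)).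
  have -> : 4%:E = \int[P]_w (2%:E + 2%:E * (Y (h ij.1 ij.2) w ^+ 2)%:E).
    rewrite ge0_integralD//; first last.
    - by apply: measurable_funeM; apply/measurable_EFinP; exact: measurable_funX.
    - by move=> w _; rewrite mule_ge0// lee_fin sqr_ge0.
    rewrite integral_probability_cst ge0_integralZl//; first last.
    - by move=> w _; rewrite lee_fin sqr_ge0.
    - by apply/measurable_EFinP; exact: measurable_funX.
    by rewrite I2 expr1n mule1 -EFinD; congr EFin; ring.
  apply: ge0_le_integral => //.
  - by apply: measurable_wrtW (mf ij); exact: mJ.
  - apply: emeasurable_funD => //.
    by apply: measurable_funeM; apply/measurable_EFinP; exact: measurable_funX.
  - move=> w _; rewrite -EFinM -EFinD lee_fin.
    rewrite -[in leRHS]real_normK ?num_real//; set y := `|_|%R.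
    by rewrite -subr_ge0 (_ : _ - _ = (1 - y) ^+ 2)%R ?sqr_ge0//; ring.
have -> : (4 ^+ (q * q))%:E = \prod_(ij : 'I_q * 'I_q) 4%:E :> \bar R.
  by rewrite prodEFin prodr_const card_prod card_ord.
elim: (index_enum _) => [|ij s IH]; first by rewrite !big_nil.
rewrite !big_cons; apply: lee_pmul => //; first exact: integral_ge0.
by apply: prode_ge0 => k _; exact: integral_ge0.
Qed.

(** The weight of a block, infinite when the block is singular. *)
Definition ext_weight (q : nat) (h : 'I_q -> 'I_q -> I) (w : T) : \bar R :=
  (1 + sqnorm (\adj (block Y h w)))%:E + inv_sqrt (\det (block Y h w)).

Definition weight_bound (q : nat) : R :=
  (1 + (q * q)%:R * det_sqr_bound q.-1 + 5 ^+ q)%R.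

Lemma ext_weight_ge0 q (h : 'I_q -> 'I_q -> I) w : 0 <= ext_weight h w.
Proof. by rewrite adde_ge0 ?inv_sqrt_ge0// lee_fin addr_ge0// sqnorm_ge0. Qed.

Lemma ext_weightE q (h : 'I_q -> 'I_q -> I) w : ext_weight h w \is a fin_num ->
  \det (block Y h w) != 0%R /\ ext_weight h w = (block_weight (block Y h w))%:E.
Proof.
rewrite /ext_weight /inv_sqrt; case: eqVneq => // _ _.
Qed.

Lemma measurable_ext_weight q (h : 'I_q -> 'I_q -> I) (J : {set I}) :
  block_index h \subset J -> measurable_wrt (joined F J) (ext_weight h).
Proof.
move=> hJ; have mb := measurable_block hJ; apply: emeasurable_funD.
  apply/measurable_EFinP; apply: measurable_funD => //.
  by apply: measurable_sqnorm; exact: measurable_adj.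
by apply: measurableT_comp; [exact: measurable_inv_sqrt|exact: measurable_det].
Qed.

Lemma integral_ext_weight q (h : 'I_q -> 'I_q -> I) : injective_index h ->
  \int[P]_w ext_weight h w <= (weight_bound q)%:E.
Proof.
move=> hI.
have mb : @measurable_mx _ T R q q (block Y h).
  by move=> i j; apply: (measurable_wrtW (mJ (J := [set: I]%SET)));
    apply: measurable_block; exact: finset.subsetT.
have mtr i j : measurable_fun setT (fun w => (\adj (block Y h w) i j ^+ 2)%:E).
  by apply/measurable_EFinP; apply: measurable_funX; exact: measurable_adj.
have mout i : measurable_fun setT (fun w => \sum_j (\adj (block Y h w) i j ^+ 2)%:E).
  exact: emeasurable_sum.
have Eentry i j : \int[P]_w (\adj (block Y h w) i j ^+ 2)%:E <= (det_sqr_bound q.-1)%:E.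
  pose h' k l := h (lift j k) (lift i l).
  rewrite (eq_integral (fun w => (\det (block Y h' w) ^+ 2)%:E)).
    by apply: integral_det_sqr; apply: sub_injective_index hI; exact: lift_inj.
  move=> w _; rewrite mxE /cofactor exprMn sqrr_sign mul1r.
  rewrite [X in \det X](_ : _ = block Y h' w)//.
  by apply/matrixP => k l; rewrite !mxE.
have -> : ext_weight h = fun w => 1 + \sum_i \sum_j (\adj (block Y h w) i j ^+ 2)%:E +
    inv_sqrt (\det (block Y h w)).
  apply/funext => w; rewrite /ext_weight EFinD /sqnorm; congr (1 + _ + _).
  by rewrite -sumEFin; apply: eq_bigr => i _; rewrite -sumEFin.
have sum0 w : 0 <= \sum_i \sum_j (\adj (block Y h w) i j ^+ 2)%:E.
  by apply: sume_ge0 => i _; apply: sume_ge0 => j _; rewrite lee_fin sqr_ge0.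
rewrite ge0_integralD//; first last.
- by apply: measurableT_comp; [exact: measurable_inv_sqrt|exact: measurable_det].
- by move=> w _; exact: inv_sqrt_ge0.
- by apply: emeasurable_funD => //; exact: emeasurable_sum.
- by move=> w _; rewrite adde_ge0.
rewrite /weight_bound !EFinD; apply: leeD; last exact: integral_inv_sqrt_det.
rewrite ge0_integralD//; last exact: emeasurable_sum.
rewrite integral_probability_cst leeD2l//.
rewrite ge0_integral_sum//; last first.
  by move=> i w _; apply: sume_ge0 => j _; rewrite lee_fin sqr_ge0.
have -> : ((q * q)%:R * det_sqr_bound q.-1)%:E =
    \sum_(i < q) \sum_(j < q) (det_sqr_bound q.-1)%:E.
  by under eq_bigr do rewrite sumEFin; rewrite sumEFin !sumr_const card_ord -mulrnA mulr_natl.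
apply: lee_sum => i _; rewrite ge0_integral_sum//; last first.
  by move=> j w _; rewrite lee_fin sqr_ge0.
exact: lee_sum.
Qed.

End GaussianKey.

(** * A lower bound for wide Gaussian matrices *)

Section GaussianLowerBound.
Context (d : measure_display) (T : measurableType d) (R : realType).
Variable P : probability T R.
Variables (q m G : nat) (Y : 'I_q * 'I_m -> {RV P >-> R}).
Hypothesis Y1 : forall i, has_normal_law 1 (Y i).
Hypothesis indepY : mutually_independent P (fun i => sigma_rv (Y i)).
Hypothesis G0 : (0 < G)%N.
Hypothesis Gm : (G * 8 * q <= m)%N.
Notation F := (fun i => sigma_rv (Y i)).
Local Open Scope ereal_scope.

Let mF i : F i `<=` measurable := @sigma_rv_measurable _ _ _ _ (Y i).
Let FI i : setI_closed (F i) := @sigma_rvI _ _ _ _ (Y i).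
Let FT i : F i setT := @sigma_rvT _ _ _ _ (Y i).
Let mJ J : joined F J `<=` measurable. Proof. exact: joined_measurable. Qed.

(** [K] indexes [G] groups of eight blocks. The columns of the blocks are numbered
    consecutively, which only requires that there be enough columns. *)
Let K : finType := ('I_G * 'I_8)%type.

Let card_cols : (#|{: K * 'I_q}| <= m)%N.
Proof. by rewrite !card_prod !card_ord. Qed.

Let col (b : K) (j : 'I_q) : 'I_m := widen_ord card_cols (enum_rank (b, j)).

Let col_inj b j b' j' : col b j = col b' j' -> (b, j) = (b', j').
Proof. by move=> E; apply: enum_rank_inj; apply: val_inj; exact: (congr1 val E). Qed.

Let h (b : K) (i j : 'I_q) : 'I_q * 'I_m := (i, col b j).

Let hI b : injective_index (h b).
Proof.
move=> [i j] [k l] /= E; rewrite [i](congr1 fst E : i = k).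
by have [->] := col_inj (congr1 snd E).
Qed.

Let W b w := ext_weight Y (h b) w.

Let mW b : measurable_wrt (joined F (block_index (h b))) (W b).
Proof. exact: measurable_ext_weight. Qed.

Let W0 b w : 0 <= W b w. Proof. exact: ext_weight_ge0. Qed.

Let dJ b b' : b != b' -> [disjoint block_index (h b) & block_index (h b')]%B.
Proof.
move=> bb'; rewrite finset.disjoints_subset; apply/fintype.subsetP => x /imsetP[ij _ ->].
rewrite inE; apply/imsetP => -[kl _ E].
by have [Eb _] := col_inj (congr1 snd E); rewrite Eb eqxx in bb'.
Qed.

Let L w := (G%:R ^- 2)%:E * \sum_(g < G) \prod_(k < 8) W (g, k) w.

Let prod0 g w : 0 <= \prod_(k < 8) W (g, k) w.
Proof. by apply: prode_ge0 => k _; exact: W0. Qed.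

Let mprod g : measurable_wrt (joined F [set: 'I_q * 'I_m]%SET) (fun w => \prod_(k < 8) W (g, k) w).
Proof.
have dg (k l : 'I_8) : k != l ->
    [disjoint block_index (h (g, k)) & block_index (h (g, l))]%B.
  by move=> kl; apply: dJ; apply: contra_neq kl => -[].
have [+ _] := integral_prod_indep indepY mF FI FT (index_enum_uniq 'I_8) dg
   (fun k => @mW (g, k)) (fun k => W0 (g, k)).
by apply: sub_measurable_wrt; apply: sub_joined; exact: finset.subsetT.
Qed.

Let Eprod g : \int[P]_w (\prod_(k < 8) W (g, k) w) <= (weight_bound R q ^+ 8)%:E.
Proof.
have dg (k l : 'I_8) : k != l ->
    [disjoint block_index (h (g, k)) & block_index (h (g, l))]%B.
  by move=> kl; apply: dJ; apply: contra_neq kl => -[].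
have [_ ->] := integral_prod_indep indepY mF FI FT (index_enum_uniq 'I_8) dg
   (fun k => @mW (g, k)) (fun k => W0 (g, k)).
have -> : (weight_bound R q ^+ 8)%:E = \prod_(k < 8) (weight_bound R q)%:E.
  by rewrite prodEFin prodr_const card_ord.
elim: (index_enum _) => [|k s IH]; first by rewrite !big_nil.
rewrite !big_cons; apply: lee_pmul => //.
- by apply: integral_ge0 => w _; exact: W0.
- by apply: prode_ge0 => l _; apply: integral_ge0 => w _; exact: W0.
- exact: integral_ext_weight.
Qed.

Let mL : measurable_wrt (joined F [set: 'I_q * 'I_m]%SET) L.
Proof. by apply: measurable_funeM; apply: emeasurable_sum. Qed.

Let L0 w : 0 <= L w.
Proof. by rewrite mule_ge0 ?lee_fin ?invr_ge0 ?sqr_ge0// sume_ge0. Qed.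

Let EL : \int[P]_w L w <= (weight_bound R q ^+ 8 / G%:R)%:E.
Proof.
have mp g : measurable_fun setT (fun w => \prod_(k < 8) W (g, k) w).
  by apply: measurable_wrtW (mprod g); exact: mJ.
rewrite ge0_integralZl//; first last.
- by move=> w _; rewrite sume_ge0.
- exact: emeasurable_sum.
rewrite ge0_integral_sum//.
apply: (@le_trans _ _ ((G%:R ^- 2)%:E * \sum_(g < G) (weight_bound R q ^+ 8)%:E)).
  by rewrite lee_wpmul2l ?lee_fin ?invr_ge0 ?sqr_ge0// lee_sum.
rewrite sumEFin sumr_const card_ord -EFinM lee_fin -mulr_natl.
have G0' : (G%:R != 0 :> R)%R by rewrite pnatr_eq0 -lt0n.
by rewrite le_eqVlt; apply/orP; left; apply/eqP; field.
Qed.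

Let W_fin : {ae P, forall w, forall b, W b w \is a fin_num}.
Proof.
apply: filter_forall => b.
have IW : P.-integrable setT (W b).
  apply/integrableP; split; first by apply: measurable_wrtW (@mW b); exact: mJ.
  under eq_integral do rewrite gee0_abs//.
  by rewrite (le_lt_trans (integral_ext_weight Y1 indepY (@hI b)))// ltry.
by have := integrable_ae measurableT IW; apply: filterS => w; apply.
Qed.

Let Zmx w : 'M[R]_(q, m) := (\matrix_(i, j) Y (i, j) w)%R.

(** The inequality holds for each block, then for each group by multiplying the
    weights, then for all blocks together by the harmonic mean; the blocks use
    distinct columns, so their contributions add up to at most [|v Z|^2]. *)
Let L_bound w : (forall b, W b w \is a fin_num) -> L w \is a fin_num /\
  bounded_below (fine (L w)) (Zmx w).
Proof.
move=> Wfin.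
pose r b := block_weight (block Y (h b) w).
have r0 b : (0 <= r b)%R := le_trans ler01 (block_weight_ge1 _).
have LE : L w = (G%:R ^- 2 * \sum_(g < G) \prod_(k < 8) r (g, k))%:E.
  rewrite EFinM -sumEFin; congr (_ * _); apply: eq_bigr => g _.
  rewrite -prodEFin; apply: eq_bigr => k _.
  by have [_] := ext_weightE (Wfin (g, k)).
split; first by rewrite LE.
move=> v; rewrite LE/=.
pose N b := sqnorm (v *m block Y (h b) w).
have N0 b : (0 <= N b)%R := sqnorm_ge0 _.
have v0 := sqnorm_ge0 v.
have vN b : (sqnorm v <= r b ^+ 8 * N b)%R.
  by have [dM _] := ext_weightE (Wfin b); exact: block_weight_bound.
have Hg g : (sqnorm v <= (\prod_(k < 8) r (g, k)) * \sum_(k < 8) N (g, k))%R.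
  by apply: (@group_bound _ 7) => //; rewrite card_ord.
have := @harmonic_bound _ G (fun g => \prod_(k < 8) r (g, k))%R
  (fun g => \sum_(k < 8) N (g, k))%R (sqnorm v) v0 _ _ Hg.
move=> /(_ _)/(_ _) H.
have {}H : (G%:R ^+ 2 * sqnorm v <= (\sum_(g < G) \prod_(k < 8) r (g, k)) *
    \sum_(g < G) \sum_(k < 8) N (g, k))%R.
  by apply: H => g; [apply: prodr_ge0|apply: sumr_ge0].
have NZ : (\sum_(g < G) \sum_(k < 8) N (g, k) <= sqnorm (v *m Zmx w))%R.
  rewrite (pair_bigA _ (fun g k => N (g, k)))/=.
  have -> : (\sum_(p : 'I_G * 'I_8) N (p.1, p.2) =
      \sum_(p : K * 'I_q) ((v *m Zmx w) 0 (col p.1 p.2)) ^+ 2)%R.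
    rewrite -(pair_bigA _ (fun (b : K) j => ((v *m Zmx w) 0 (col b j)) ^+ 2)%R)/=.
    apply: eq_bigr => -[g k] _ /=; rewrite /N /sqnorm big_ord1.
    apply: eq_bigr => j _; congr (_ ^+ 2)%R; rewrite !mxE.
    by apply: eq_bigr => i _; rewrite !mxE.
  rewrite /sqnorm big_ord1.
  rewrite -(@big_imset _ _ _ _ _ (fun p : K * 'I_q => col p.1 p.2) predT
     (fun l => ((v *m Zmx w) 0 l) ^+ 2)%R)/=; last first.
    by move=> [b j] [b' j'] _ _ /= /col_inj.
  rewrite [leRHS](bigID (mem [set col p.1 p.2 | p : K * 'I_q]%SET))/=.
  rewrite lerDl sumr_ge0// => l _; exact: sqr_ge0.
rewrite -mulrA ler_pdivlMl ?exprn_gt0 ?ltr0n//.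
rewrite (le_trans H)// ler_wpM2l// sumr_ge0// => g _; exact: prodr_ge0.
Qed.

(** Each group contributes a product of eight independent weights, of mean at most
    [weight_bound q ^+ 8], and the harmonic mean divides the total by [G ^+ 2].
    That [c] is measurable for the sigma-algebra of [Y] lets it be separated from
    data that are independent of [Y]. *)
Lemma gaussian_lower_bound : exists c : T -> R,
  [/\ measurable_wrt (joined F [set: 'I_q * 'I_m]%SET) c,
      (forall w, (0 <= c w)%R),
      \int[P]_w (c w)%:E <= (weight_bound R q ^+ 8 / G%:R)%:E &
      {ae P, forall w, bounded_below (c w) (\matrix_(i, j) Y (i, j) w)%R}].
Proof.
exists (fine \o L).
have mc : measurable_wrt (joined F [set: 'I_q * 'I_m]%SET) (fine \o L).
  by apply: measurableT_comp mL => //; exact: measurable_fine.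
split => //.
- by move=> w; exact: fine_ge0.
- apply: le_trans EL; apply: ge0_le_integral => //.
  + by move=> w _; rewrite lee_fin; exact: fine_ge0.
  + by apply/measurable_EFinP; apply: measurable_wrtW mc; exact: mJ.
  + by apply: measurable_wrtW mL; exact: mJ.
  + move=> w _; have := L0 w; rewrite /= -/(L w); case: (L w) => [r _|_|//] /=; first exact: lexx.
    by rewrite leey.
- by apply: filterS W_fin => w /L_bound[].
Qed.

End GaussianLowerBound.


(** * Enlarged designs *)

Section Extensions.
Context (R : realType).
Variables (k0 k : nat).
Hypothesis k0k : (k0 <= k)%N.

Lemma sum_extend (f : 'I_(k0 + (k - k0)) -> R) :
  \sum_(i < k) f (widen_ord (leq_addB k0 k) i) =
  \sum_(i < k0) f (lshift _ i) + \sum_(j < k - k0) f (rshift _ j).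
Proof.
have e : (k0 + (k - k0) = k)%N by rewrite subnKC.
rewrite (reindex (cast_ord e))/=; last first.
  by exists (cast_ord (esym e)) => i _; rewrite ?cast_ordK ?cast_ordKV.
rewrite (eq_bigr f); first exact: big_split_ord.
by move=> i _; congr f; exact: val_inj.
Qed.

Lemma sqnorm_mul_extend_cols m q (v : 'M[R]_(q, m)) (A : 'M[R]_(m, k0)) (B : 'M[R]_(m, k - k0)) :
  sqnorm (v *m extend_cols A B) = sqnorm (v *m A) + sqnorm (v *m B).
Proof.
rewrite /sqnorm -big_split/=; apply: eq_bigr => i _.
transitivity (\sum_l ((v *m row_mx A B) i (widen_ord (leq_addB k0 k) l)) ^+ 2).
  apply: eq_bigr => j _; congr (_ ^+ 2); rewrite !mxE.
  by apply: eq_bigr => l _; rewrite !mxE.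
rewrite (sum_extend (fun l => ((v *m row_mx A B) i l) ^+ 2)) mul_mx_row.
by congr (_ + _); apply: eq_bigr => l _; rewrite ?row_mxEl ?row_mxEr.
Qed.

Lemma mul_extend_cols_rows m q (A : 'M[R]_(m, k0)) (B : 'M[R]_(m, k - k0))
    (C : 'M[R]_(k0, q)) (D : 'M[R]_(k - k0, q)) :
  extend_cols A B *m extend_rows C D = A *m C + B *m D.
Proof.
apply/matrixP => i j; rewrite !mxE.
pose f l := row_mx A B i l * col_mx C D l j.
rewrite -[LHS](_ : \sum_l f (widen_ord (leq_addB k0 k) l) = _); last first.
  by apply: eq_bigr => l _; rewrite /f !mxE.
rewrite sum_extend; congr (_ + _); apply: eq_bigr => l _.
  by rewrite /f row_mxEl col_mxEu.
by rewrite /f row_mxEr col_mxEd.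
Qed.

Lemma tr_extend_rows m (A : 'M[R]_(k0, m)) (B : 'M[R]_(k - k0, m)) :
  (extend_rows A B)^T = extend_cols A^T B^T.
Proof. by apply/matrixP => i j; rewrite !mxE; case: (fintype.split _) => l; rewrite mxE. Qed.

Lemma sqnorm_extend_rows0 m (A : 'M[R]_(k0, m)) :
  sqnorm (extend_rows A 0 : 'M[R]_(k, m)) = sqnorm A.
Proof.
rewrite -sqnorm_tr tr_extend_rows -[extend_cols _ _]mul1mx sqnorm_mul_extend_cols.
by rewrite !mul1mx !sqnorm_tr sqnorm0 addr0.
Qed.

(** Columns can only increase [|v D|]. *)
Lemma bounded_below_extend_cols c m (A : 'M[R]_(m, k0)) (B : 'M[R]_(m, k - k0)) :
  0 <= c -> bounded_below c B -> bounded_below c (extend_cols A B).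
Proof.
move=> c0 cB v; rewrite (le_trans (cB v))// ler_wpM2l// sqnorm_mul_extend_cols.
by rewrite lerDr sqnorm_ge0.
Qed.

End Extensions.

Section Estimators.
Context (R : realType).

(** The added columns matter only through [c]: their coefficients in the padded
    [beta] are 0, so the design maps it to [X *m beta]. *)
Lemma ols_extend_cols_bound (n0 d0 d : nat) (c : R) (X : 'M[R]_(n0, d0))
    (Z : 'M[R]_(n0, d - d0)) (u : 'cV_n0) (beta : 'cV_d0) :
  (d0 <= d)%N -> (n0 < d)%N -> 0 <= c -> bounded_below c Z ->
  `|sqnorm (extend_rows beta 0 - ols u (extend_cols X Z)) - sqnorm beta| <=
    c * (2 * sqnorm u + sqnorm (X *m beta)).
Proof.
move=> d0d n0d c0 cZ; rewrite /ols leqNgt n0d/=.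
have := @min_norm_bound _ c c0 _ _ (extend_cols X Z) u (extend_rows beta 0)
  (bounded_below_extend_cols d0d X c0 cZ).
by rewrite sqnorm_extend_rows0// mul_extend_cols_rows// mulmx0 addr0.
Qed.

(** The added responses are 0, so [D^T] maps the padded responses to [X^T *m u],
    of norm at most [|X| |u| <= (|X|^2 + |u|^2) / 2]. *)
Lemma ols_extend_rows_bound (n0 d0 n : nat) (c : R) (X : 'M[R]_(n0, d0))
    (W : 'M[R]_(n - n0, d0)) (u : 'cV_n0) (beta : 'cV_d0) :
  (n0 <= n)%N -> (d0 <= n)%N -> 0 <= c -> bounded_below c W^T ->
  `|sqnorm (beta - ols (extend_rows u 0 : 'cV_n) (extend_rows X W)) - sqnorm beta| <=
    c * (sqnorm u + (1 + sqnorm beta) * (sqnorm X + sqnorm u)).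
Proof.
move=> n0n d0n c0 cW; rewrite /ols d0n.
have X0 := sqnorm_ge0 X; have u0 := sqnorm_ge0 u.
have F0 : 0 <= (sqnorm X + sqnorm u) / 2 by rewrite divr_ge0 ?addr_ge0.
have := @least_squares_bound _ c c0 _ _ (extend_rows X W) (extend_rows u 0) beta _ _ F0.
rewrite sqnorm_extend_rows0// tr_extend_rows mul_extend_cols_rows// mulmx0 addr0.
move=> /(_ (bounded_below_extend_cols n0n _ c0 cW)).
rewrite [2 * _]mulrC divfK// ?pnatr_eq0//; apply => //.
rewrite (le_trans (sqnormM_le _ _))// sqnorm_tr.
by have := sqr_ge0 (sqnorm X - sqnorm u); lra.
Qed.

End Estimators.


(** * Independence of the entries and of the test point *)

Section IndependentEntries.
Context (d : measure_display) (T : measurableType d) (R : realType).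
Variable P : probability T R.
Local Open Scope ereal_scope.

Lemma mutually_independent_pair (I : finType) (F : I -> set (set T)) i j :
  mutually_independent P F -> i != j -> independent_classes P (F i) (F j).
Proof.
move=> iF ij A B FA FB.
pose C k := if k == i then A else B.
have Ci : C i = A by rewrite /C eqxx.
have Cj : C j = B by rewrite /C eq_sym (negbTE ij).
have := iF [set i; j]%SET C; rewrite big_setU1 ?inE//= big_set1 Ci Cj => <-.
  congr (P _); apply/seteqP; split=> [w [Aw Bw] k /=|w Cw].
    by rewrite !inE => /orP[|] /eqP ->; rewrite ?Ci ?Cj.
  by split; [rewrite -Ci|rewrite -Cj]; apply: Cw; rewrite /= !inE eqxx ?orbT.
by move=> k; rewrite !inE => /orP[|] /eqP ->; rewrite ?Ci ?Cj.
Qed.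

Lemma mutually_independent_reindex (I K : finType) (f : K -> I) (g : I -> K)
    (F : I -> set (set T)) :
  cancel f g -> mutually_independent P F -> mutually_independent P (F \o f).
Proof.
move=> fK iF J A FA.
have := iF (f @: J)%SET (A \o g); rewrite big_imset/=; last first.
  by move=> k l _ _; exact: (can_inj fK).
under eq_bigr do rewrite fK.
move=> <-.
  congr (P _); apply/seteqP; split=> w Aw k /=.
    by move=> /imsetP[l lJ ->]; rewrite fK; exact: Aw.
  by move=> kJ; have := Aw (f k); rewrite /= fK; apply; exact: imset_f.
by move=> i /imsetP[l lJ ->]; rewrite /= fK; exact: FA.
Qed.

Section SigmaMx.
Context (m p : nat).
Implicit Type M : 'M[{RV P >-> R}]_(m, p).

Lemma sigma_mx_measurable M : sigma_mx M `<=` measurable.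
Proof.
apply: smallest_sub; first exact: sigma_algebra_measurable.
by move=> A [ij _]; exact: sigma_rv_measurable.
Qed.

Lemma sigma_mxT M : sigma_mx M setT.
Proof.
pose G := \bigcup_(ij in [set: 'I_m * 'I_p]) sigma_rv (M ij.1 ij.2).
exact: (@measurableT _ (g_sigma_algebraType G)).
Qed.

Lemma sigma_mx_bigcap M (I : finType) (J : {set I}) (A : I -> set T) :
  (forall i, i \in J -> sigma_mx M (A i)) ->
  sigma_mx M (\bigcap_(i in [set` J]) A i).
Proof.
move=> MA.
pose G := \bigcup_(ij in [set: 'I_m * 'I_p]) sigma_rv (M ij.1 ij.2).
by apply: (@fin_bigcap_measurable _ (g_sigma_algebraType G)).
Qed.

Lemma sigma_mxI M : setI_closed (sigma_mx M).
Proof.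
move=> A B MA MB.
pose G := \bigcup_(ij in [set: 'I_m * 'I_p]) sigma_rv (M ij.1 ij.2).
exact: (@measurableI _ (g_sigma_algebraType G)).
Qed.

Lemma sub_sigma_mx M i j : sigma_rv (M i j) `<=` sigma_mx M.
Proof. by move=> A MA; apply: sub_sigma_algebra; exists (i, j). Qed.

End SigmaMx.

(** The conditions under which members of a mutually independent family of classes
    can be grouped. *)
Definition independence_class (F : set (set T)) :=
  [/\ F `<=` measurable, setI_closed F & F setT].

Lemma independence_class_mx m p (M : 'M[{RV P >-> R}]_(m, p)) :
  independence_class (sigma_mx M).
Proof.
split; [exact: sigma_mx_measurable|exact: sigma_mxI|exact: sigma_mxT].
Qed.

Lemma independence_class_rv (X : {RV P >-> R}) : independence_class (sigma_rv X).
Proof.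
split; [exact: sigma_rv_measurable|exact: sigma_rvI|exact: sigma_rvT].
Qed.

Lemma design_normal m p (M : 'M[{RV P >-> R}]_(m, p)) : is_normal_design M ->
  forall ij : 'I_m * 'I_p, has_normal_law 1 (M ij.1 ij.2).
Proof.
by move=> [HM _] [i j] /=; have [/(_ j) + _] := HM i; rewrite !mxE.
Qed.

(** The events prescribed for the entries of one row intersect in an event of the
    sigma-algebra of that row. The rule for rows, then the rule within each row,
    give the product over all entries. *)
Lemma design_independent m p (M : 'M[{RV P >-> R}]_(m, p)) : is_normal_design M ->
  mutually_independent P (fun ij : 'I_m * 'I_p => sigma_rv (M ij.1 ij.2)).
Proof.
move=> [HM iM] J A JA.
pose Ji (i : 'I_m) := [set j | (i, j) \in J]%SET.
pose B i := \bigcap_(j in [set` Ji i]) A (i, j).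
have HB i : sigma_mx (row i M) (B i).
  apply: sigma_mx_bigcap => j; rewrite inE => ijJ.
  have := @sub_sigma_mx 1 p (row i M) 0%R j (A (i, j)); rewrite mxE; apply.
  exact: (JA (i, j)).
have -> : \bigcap_(ij in [set` J]) A ij = \bigcap_(i in [set` [set: 'I_m]%SET]) B i.
  apply/seteqP; split=> w Aw.
    by move=> i _ j /=; rewrite inE => ijJ; exact: (Aw (i, j)).
  move=> [i j] /= ijJ; apply: (Aw i); rewrite /= ?inE//.
rewrite iM//.
transitivity (\prod_(i in [set: 'I_m]%SET) \prod_(j in Ji i) P (A (i, j))).
  apply: eq_bigr => i _; have [_ ir] := HM i.
  rewrite -(ir (Ji i) (fun j => A (i, j)))// => j; rewrite inE => ijJ.
  by rewrite !mxE; exact: (JA (i, j)).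
under eq_bigl do rewrite inE.
rewrite pair_big_dep/=; apply: eq_big => [[i j]|[i j] _]//=.
by rewrite inE.
Qed.

End IndependentEntries.

Section SecondMoments.
Context (d : measure_display) (T : measurableType d) (R : realType).
Variable P : probability T R.
Local Open Scope ereal_scope.

Lemma integral_sqr_lincomb (K : finType) (U : K -> {RV P >-> R}) (v a : K -> R) :
  (forall k, P.-integrable setT (EFin \o U k)) ->
  (forall k, P.-integrable setT (fun w => (U k w ^+ 2)%:E)) ->
  (forall k, \int[P]_w (U k w)%:E = 0) ->
  (forall k, \int[P]_w (U k w ^+ 2)%:E = (v k)%:E) ->
  (forall k l, k != l -> independent_classes P (sigma_rv (U k)) (sigma_rv (U l))) ->
  \int[P]_w ((\sum_k U k w * a k) ^+ 2)%:E = (\sum_k a k ^+ 2 * v k)%:E.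
Proof.
move=> IU IU2 EU EU2 iU.
have IUU k l : P.-integrable setT (fun w => (U k w * U l w)%:E).
  have [<-|kl] := eqVneq k l; last by have [] := integralM_indep_rv (iU _ _ kl) (IU k) (IU l).
  by apply: eq_integrable (IU2 k) => // w _; rewrite expr2.
transitivity (\int[P]_w (\sum_k \sum_l ((a k * a l)%:E * (U k w * U l w)%:E))).
  apply: eq_integral => w _; rewrite expr2 big_distrlr/= -sumEFin; apply: eq_bigr => k _.
  rewrite -sumEFin; apply: eq_bigr => l _; rewrite -EFinM; congr EFin.
  by ring.
have Iin k : P.-integrable setT (fun w => \sum_l ((a k * a l)%:E * (U k w * U l w)%:E)).
  by apply: integrable_sum => // l _; exact: (integrableZl measurableT _ (IUU k l)).
rewrite integral_sum// -sumEFin; apply: eq_bigr => k _.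
rewrite integral_sum//; last by move=> l; exact: (integrableZl measurableT _ (IUU k l)).
rewrite (bigD1 k)//= big1 ?adde0; last first.
  move=> l lk; rewrite integralZl//.
  have [_ ->] := integralM_indep_rv (iU _ _ (contra_neq esym lk)) (IU k) (IU l).
  by rewrite EU mul0e mule0.
rewrite integralZl// (eq_integral (fun w => (U k w ^+ 2)%:E)).
  by rewrite EU2 -EFinM -expr2.
by move=> w _; rewrite expr2.
Qed.

(** The training data are frozen by decoupling. What remains is the second moment
    of a combination, with constant coefficients, of pairwise uncorrelated
    variables: the test predictors and the test noise. *)
Lemma integral_test_error (p : nat) (s : R) (Gtr Gte : set (set T))
    (x : 'I_p -> {RV P >-> R}) (e : {RV P >-> R}) (b : T -> 'cV[R]_p) :
  (0 < s)%R -> Gtr `<=` measurable -> Gte `<=` measurable ->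
  independent_classes P <<s Gtr >> <<s Gte >> ->
  (forall i, measurable_wrt Gte (x i)) -> measurable_wrt Gte e ->
  @measurable_mx _ (g_sigma_algebraType Gtr) R p 1 b ->
  (forall i, has_normal_law 1 (x i)) -> has_normal_law s e ->
  (forall i j, i != j -> independent_classes P (sigma_rv (x i)) (sigma_rv (x j))) ->
  (forall i, independent_classes P (sigma_rv (x i)) (sigma_rv e)) ->
  \int[P]_w ((\sum_i x i w * b w i 0 + e w) ^+ 2)%:E =
  \int[P]_w (sqnorm (b w) + s ^+ 2)%:E.
Proof.
move=> s0 mtr mte itt mx me mb nx ne ixx ixe.
pose f (z : g_sigma_algebraType Gtr * g_sigma_algebraType Gte) :=
  ((\sum_i x i z.2 * b z.1 i 0 + e z.2) ^+ 2)%:E.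
have f0 z : 0 <= f z by rewrite lee_fin sqr_ge0.
have mf : measurable_fun setT f.
  apply/measurable_EFinP; apply: measurable_funX; apply: measurable_funD.
    apply: measurable_sum => i; apply: measurable_funM.
      exact: measurableT_comp (mx i) measurable_snd.
    exact: measurableT_comp (mb i 0%R) measurable_fst.
  exact: measurableT_comp me measurable_snd.
rewrite (decoupling_sigma mtr mte itt mf f0).
apply: eq_integral => w1 _; rewrite /f/=.
pose U (k : 'I_p + 'I_1) := match k with inl i => x i | inr _ => e end.
pose v (k : 'I_p + 'I_1) : R := match k with inl _ => 1%R | inr _ => (s ^+ 2)%R end.
pose a (k : 'I_p + 'I_1) : R := match k with inl i => b w1 i 0%R | inr _ => 1%R end.
transitivity (\int[P]_w ((\sum_k U k w * a k) ^+ 2)%:E).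
  by apply: eq_integral => w _; rewrite big_sumType/= big_ord1 mulr1.
rewrite (@integral_sqr_lincomb _ U v a).
- rewrite big_sumType/= big_ord1 expr1n mul1r sqnorm_colE.
  by under eq_bigr do rewrite mulr1.
- by case=> i /=; [exact: normal_rv_integrable ltr01 (nx i)|exact: normal_rv_integrable s0 ne].
- by case=> i /=; [exact: normal_rv_sqr_integrable ltr01 (nx i)|exact: normal_rv_sqr_integrable s0 ne].
- by case=> i /=; [exact: normal_rv_mean ltr01 (nx i)|exact: normal_rv_mean s0 ne].
- case=> i /=; last exact: normal_rv_sqr s0 ne.
  by rewrite (normal_rv_sqr ltr01 (nx i)) expr1n.
- case=> [i|i] [j|j] // ij.
  + by apply: ixx; apply: contra_neq ij => ->.
  + exact: ixe.
  + by apply: independent_classes_sym; exact: ixe.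
  + by rewrite !ord1 eqxx in ij.
Qed.

(** Comparing nonnegative integrals in both directions, [h <= s + c * Q] and
    [s <= h + c * Q], makes the finiteness of the integral of [h] a conclusion. *)
Lemma ae_near_bound (h c Q : T -> R) (s C K : R) :
  measurable_fun setT h -> measurable_fun setT c -> measurable_fun setT Q ->
  (forall w, (0 <= h w)%R) -> (forall w, (0 <= c w)%R) -> (forall w, (0 <= Q w)%R) ->
  (0 <= s)%R -> (0 <= C)%R -> (0 <= K)%R ->
  {ae P, forall w, (`|h w - s| <= c w * Q w)%R} ->
  \int[P]_w ((c w)%:E * (Q w)%:E) = \int[P]_w (c w)%:E * \int[P]_w (Q w)%:E ->
  \int[P]_w (c w)%:E <= C%:E -> \int[P]_w (Q w)%:E <= K%:E ->
  \int[P]_w (h w)%:E \is a fin_num /\ (`|fine (\int[P]_w (h w)%:E) - s| <= C * K)%R.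
Proof.
move=> mh mc mQ h0 c0 Q0 s0 C0 K0 hs EcQ Ec EQ.
have mcQ : measurable_fun setT (fun w => (c w * Q w)%:E).
  by apply/measurable_EFinP; exact: measurable_funM.
have mhE : measurable_fun setT (fun w => (h w)%:E) by exact/measurable_EFinP.
have cQ0 w : 0 <= (c w * Q w)%:E by rewrite lee_fin mulr_ge0.
have IcQ : \int[P]_w (c w * Q w)%:E <= (C * K)%:E.
  by rewrite EcQ EFinM lee_pmul// integral_ge0// => w _; rewrite lee_fin.
have up : \int[P]_w (h w)%:E <= (s + C * K)%:E.
  apply: (@le_trans _ _ (\int[P]_w (s%:E + (c w * Q w)%:E))).
    apply: ae_ge0_le_integral => //.
    - by move=> w _; rewrite lee_fin.
    - by move=> w _; rewrite adde_ge0.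
    - exact: emeasurable_funD.
    - apply: filterS hs => w + _; rewrite -EFinD lee_fin ler_norml => /andP[_].
      by rewrite lerBlDl.
  rewrite ge0_integralD//.
  by rewrite integral_probability_cst EFinD leeD2l.
have low : s%:E <= \int[P]_w (h w)%:E + (C * K)%:E.
  apply: (@le_trans _ _ (\int[P]_w ((h w)%:E + (c w * Q w)%:E))).
    rewrite -[leLHS](integral_probability_cst P); apply: ae_ge0_le_integral => //.
    - by move=> w _; rewrite adde_ge0// lee_fin.
    - exact: emeasurable_funD.
    - apply: filterS hs => w + _; rewrite -EFinD lee_fin ler_norml => /andP[+ _].
      by rewrite lerBrDl lerBlDr.
  rewrite ge0_integralD//; first by rewrite leeD2l.
  by move=> w _; rewrite lee_fin.
have fin : \int[P]_w (h w)%:E \is a fin_num.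
  rewrite ge0_fin_numE; first by rewrite (le_lt_trans up)// ltry.
  by apply: integral_ge0 => w _; rewrite lee_fin.
split => //.
rewrite -(fineK fin) in up low; move: up low; rewrite -EFinD !lee_fin => up low.
by rewrite ler_norml; apply/andP; split; lra.
Qed.

End SecondMoments.


(** * Asymptotics of the test errors *)

Section MeasurableEstimator.
Context (d : measure_display) (S : measurableType d) (R : realType).

Lemma measurable_extend_cols m k0 k (A : S -> 'M[R]_(m, k0)) (B : S -> 'M[R]_(m, k - k0)) :
  measurable_mx A -> measurable_mx B ->
  measurable_mx (fun w => extend_cols (A w) (B w) : 'M[R]_(m, k)).
Proof.
move=> mA mB i j; under eq_fun do rewrite !mxE.
by case: (fintype.split _) => l; [exact: mA|exact: mB].
Qed.

Lemma measurable_extend_rows m k0 k (A : S -> 'M[R]_(k0, m)) (B : S -> 'M[R]_(k - k0, m)) :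
  measurable_mx A -> measurable_mx B ->
  measurable_mx (fun w => extend_rows (A w) (B w) : 'M[R]_(k, m)).
Proof.
move=> mA mB i j; under eq_fun do rewrite !mxE.
by case: (fintype.split _) => l; [exact: mA|exact: mB].
Qed.

Lemma measurable_cst_mx m n (M : 'M[R]_(m, n)) : measurable_mx (fun _ : S => M).
Proof. by move=> i j; exact: measurable_cst. Qed.

Lemma measurable_submx m n (A B : S -> 'M[R]_(m, n)) :
  measurable_mx A -> measurable_mx B -> measurable_mx (fun w => A w - B w).
Proof.
by move=> mA mB i j; under eq_fun do rewrite !mxE; exact: measurable_funB.
Qed.

Lemma measurable_ols m p (u : S -> 'cV[R]_m) (D : S -> 'M[R]_(m, p)) :
  measurable_mx u -> measurable_mx D -> measurable_mx (fun w => ols (u w) (D w)).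
Proof.
move=> mu mD; have mDT := measurable_trmx mD; rewrite /ols; case: (p <= m)%N.
  apply: measurable_mulmx => //; apply: measurable_mulmx => //.
  by apply: measurable_invmx; exact: measurable_mulmx.
apply: measurable_mulmx => //; apply: measurable_mulmx => //.
by apply: measurable_invmx; exact: measurable_mulmx.
Qed.

End MeasurableEstimator.

Section Groups.
Context (d : measure_display) (T : measurableType d) (R : realType).
Variable P : probability T R.
Variables (I : finType) (F : I -> set (set T)).
Local Open Scope ereal_scope.

Lemma measurable_joined_rv (J : {set I}) i (X : {RV P >-> R}) :
  i \in J -> sigma_rv X `<=` F i -> measurable_wrt (joined F J) X.
Proof.
move=> iJ XF; apply: measurable_wrt_rv => A XA; apply: sub_sigma_algebra.
by exists i => //; exact: XF.
Qed.

Lemma measurable_joined_sample (J : {set I}) i m p (M : 'M[{RV P >-> R}]_(m, p)) :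
  i \in J -> sigma_mx M `<=` F i ->
  @measurable_mx _ (g_sigma_algebraType (joined F J)) R m p (sample M).
Proof.
move=> iJ MF k l; apply: (@eq_measurable_wrt _ _ _ _ (M k l)) => [w|].
  by rewrite mxE.
by apply: (measurable_joined_rv iJ) => A MA; apply: MF; exact: sub_sigma_mx MA.
Qed.

Lemma disjoint_predicates (p q : pred I) : (forall i, p i -> ~~ q i) ->
  [disjoint [set i | p i]%SET & [set i | q i]%SET]%B.
Proof.
move=> pq; rewrite finset.disjoints_subset; apply/fintype.subsetP => i.
by rewrite !inE; exact: pq.
Qed.

End Groups.

Section Core.
Context (d : measure_display) (T : measurableType d) (R : realType).
Variable P : probability T R.
Local Open Scope ereal_scope.

Lemma integral_sqnorm_sample m p (s : R) (M : 'M[{RV P >-> R}]_(m, p)) :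
  (0 < s)%R -> (forall i j, has_normal_law s (M i j)) ->
  \int[P]_w (sqnorm (sample M w))%:E = ((m * p)%:R * s ^+ 2)%:E.
Proof.
move=> s0 nM.
have mM i j : measurable_fun setT (fun w => (M i j w ^+ 2)%:E).
  by apply/measurable_EFinP; exact: measurable_funX.
transitivity (\int[P]_w (\sum_i \sum_j (M i j w ^+ 2)%:E)).
  apply: eq_integral => w _; rewrite -sumEFin; apply: eq_bigr => i _.
  by rewrite -sumEFin; apply: eq_bigr => j _; rewrite mxE.
rewrite ge0_integral_sum//; last 2 first.
- by move=> i; exact: emeasurable_sum.
- by move=> i w _; apply: sume_ge0 => j _; rewrite lee_fin sqr_ge0.
transitivity (\sum_(i < m) \sum_(j < p) (s ^+ 2)%:E : \bar R).
  apply: eq_bigr => i _; rewrite ge0_integral_sum//; last first.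
    by move=> j w _; rewrite lee_fin sqr_ge0.
  by apply: eq_bigr => j _; exact: normal_rv_sqr.
under eq_bigr do rewrite sumEFin.
by rewrite sumEFin !sumr_const !card_ord -mulrnA mulr_natl mulnC.
Qed.

(** The argument shared by the two sequences: [c] is a function of the added
    matrix, [Q] of the original sample, [b] is the error of the estimator and
    [s0] the squared norm of the true coefficients. *)
Lemma test_error_core (p : nat) (s s0 C K : R) (Gtr Gte Gc GQ : set (set T))
    (x : 'I_p -> {RV P >-> R}) (e : {RV P >-> R}) (b : T -> 'cV[R]_p)
    (c Q : T -> R) :
  (0 < s)%R -> Gtr `<=` measurable -> Gte `<=` measurable ->
  Gc `<=` measurable -> GQ `<=` measurable ->
  independent_classes P <<s Gtr >> <<s Gte >> ->
  independent_classes P <<s Gc >> <<s GQ >> ->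
  (forall i, measurable_wrt Gte (x i)) -> measurable_wrt Gte e ->
  @measurable_mx _ (g_sigma_algebraType Gtr) R p 1 b ->
  (forall i, has_normal_law 1 (x i)) -> has_normal_law s e ->
  (forall i j, i != j -> independent_classes P (sigma_rv (x i)) (sigma_rv (x j))) ->
  (forall i, independent_classes P (sigma_rv (x i)) (sigma_rv e)) ->
  measurable_wrt Gc c -> measurable_wrt GQ Q ->
  (forall w, (0 <= c w)%R) -> (forall w, (0 <= Q w)%R) ->
  (0 <= s0)%R -> (0 <= C)%R -> (0 <= K)%R ->
  {ae P, forall w, (`|sqnorm (b w) - s0| <= c w * Q w)%R} ->
  \int[P]_w (c w)%:E <= C%:E -> \int[P]_w (Q w)%:E <= K%:E ->
  let E := \int[P]_w ((\sum_i x i w * b w i 0 + e w) ^+ 2)%:E in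
  E \is a fin_num /\ (`|fine E - (s ^+ 2 + s0)| <= C * K)%R.
Proof.
move=> sgt0 mtr mte mGc mGQ itt icQ mx me mb nx ne ixx ixe mc mQ c0 Q0 s00 C0 K0 Hb Ec EQ E.
have mbT : measurable_fun setT (fun w => sqnorm (b w)).
  by apply: measurable_wrtW mtr _; exact: measurable_sqnorm.
have EcQ : \int[P]_w ((c w)%:E * (Q w)%:E) = \int[P]_w (c w)%:E * \int[P]_w (Q w)%:E.
  apply: (integralM_indep_sigma mGc mGQ icQ).
  - exact/measurable_EFinP.
  - exact/measurable_EFinP.
  - by move=> w; rewrite lee_fin.
  - by move=> w; rewrite lee_fin.
have [Hfin Hle] := ae_near_bound mbT (measurable_wrtW mGc mc) (measurable_wrtW mGQ mQ)
  (fun w => sqnorm_ge0 (b w)) c0 Q0 s00 C0 K0 Hb EcQ Ec EQ.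
have EE : E = \int[P]_w (sqnorm (b w))%:E + (s ^+ 2)%:E.
  rewrite /E (integral_test_error sgt0 mtr mte)//.
  under eq_integral do rewrite EFinD.
  rewrite ge0_integralD//.
  - by rewrite integral_probability_cst.
  - by move=> w _; rewrite lee_fin sqnorm_ge0.
  - exact/measurable_EFinP.
  - by move=> w _; rewrite lee_fin sqr_ge0.
rewrite EE; split; first by rewrite fin_numD Hfin.
rewrite fineD// (_ : _ - _ = fine (\int[P]_w (sqnorm (b w))%:E) - s0)%R//=.
by ring.
Qed.

End Core.


Section Rate.
Context (R : realType).

Lemma weight_bound_ge0 q : 0 <= weight_bound R q.
Proof.
by rewrite /weight_bound /det_sqr_bound !addr_ge0 ?mulr_ge0 ?exprn_ge0 ?ler0n.
Qed.

Definition rate_cst (q : nat) : R := weight_bound R q ^+ 8 * (16 * q)%:R.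

Lemma rate_cst_ge0 q : 0 <= rate_cst q.
Proof. by rewrite mulr_ge0 ?exprn_ge0 ?weight_bound_ge0. Qed.

(** The number of groups is the quotient of the number [k - k0] of added columns
    by [8 * q]. Once [k] is at least [2 * (k0 + 8 * q)], removing [k0] columns and
    rounding down loses at most half of the columns, whence the constant 16. *)
Lemma gaussian_lower_bound_rate (d : measure_display) (T : measurableType d)
    (P : probability T R) (q k0 k : nat) (Y : 'I_q * 'I_(k - k0) -> {RV P >-> R}) :
  (0 < q)%N -> (2 * (k0 + 8 * q) <= k)%N ->
  (forall ij, has_normal_law 1 (Y ij)) ->
  mutually_independent P (fun ij => sigma_rv (Y ij)) ->
  exists c : T -> R,
  [/\ measurable_wrt (joined (fun ij => sigma_rv (Y ij)) [set: 'I_q * 'I_(k - k0)]%SET) c,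
      (forall w, 0 <= c w),
      (\int[P]_w (c w)%:E <= (rate_cst q / k%:R)%:E)%E &
      {ae P, forall w, bounded_below (c w) (\matrix_(i, j) Y (i, j) w)}].
Proof.
move=> q0 kbig Y1 iY; pose G := ((k - k0) %/ (8 * q))%N.
have divG := divn_eq (k - k0) (8 * q).
have modG : ((k - k0) %% (8 * q) < 8 * q)%N by rewrite ltn_mod muln_gt0.
have G0 : (0 < G)%N by rewrite divn_gt0 ?muln_gt0//; lia.
have Gm : (G * 8 * q <= k - k0)%N by rewrite -mulnA; rewrite /G; lia.
have kG : (k <= G * (16 * q))%N by rewrite /G; lia.
have [c [mc c0 Ec bc]] := gaussian_lower_bound Y1 iY G0 Gm.
exists c; split => //; apply: (le_trans Ec); rewrite lee_fin /rate_cst -mulrA.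
rewrite ler_wpM2l ?exprn_ge0 ?weight_bound_ge0//.
have k0' : (0 : R) < k%:R by rewrite ltr0n; lia.
rewrite -[leLHS]mul1r ler_pdivlMr// mulrAC ler_pdivrMr ?ltr0n// mul1r.
by rewrite -natrM ler_nat mulnC.
Qed.

Variables (n0 d0 : nat).

(** Large enough for both sequences; what matters is that the remainders are then
    quadratic in the sample, so that second moments suffice. *)
Definition design_cst (beta : 'cV[R]_d0) : R := 10 * (1 + sqnorm beta) ^+ 2.

Lemma design_cst_ge0 beta : 0 <= design_cst beta.
Proof. by rewrite mulr_ge0 ?sqr_ge0. Qed.

Lemma min_norm_remainder (X : 'M[R]_(n0, d0)) (e : 'cV_n0) (beta : 'cV_d0) :
  2 * sqnorm (X *m beta + e) + sqnorm (X *m beta) <=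
  design_cst beta * (sqnorm X + sqnorm e).
Proof.
have := sqnormD_le (X *m beta) e; have := sqnormM_le X beta.
have := sqnorm_ge0 X; have := sqnorm_ge0 e; have := sqnorm_ge0 beta.
rewrite /design_cst; set x := sqnorm X; set b := sqnorm beta; set y := sqnorm e.
set z := sqnorm (X *m beta); move=> b0 y0 x0 zx.
by nra.
Qed.

Lemma least_squares_remainder (X : 'M[R]_(n0, d0)) (e : 'cV_n0) (beta : 'cV_d0) :
  sqnorm (X *m beta + e) + (1 + sqnorm beta) * (sqnorm X + sqnorm (X *m beta + e)) <=
  design_cst beta * (sqnorm X + sqnorm e).
Proof.
have := sqnormD_le (X *m beta) e; have := sqnormM_le X beta.
have := sqnorm_ge0 X; have := sqnorm_ge0 e; have := sqnorm_ge0 beta.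
rewrite /design_cst; set x := sqnorm X; set b := sqnorm beta; set y := sqnorm e.
set z := sqnorm (X *m beta); set u := sqnorm (_ + _); move=> b0 y0 x0 zx uz.
have uxy : u <= 2 * (b * x + y) by nra.
have : (2 + b) * u <= (2 + b) * (2 * (b * x + y)) by rewrite ler_wpM2l// addr_ge0.
by have := mulr_ge0 b0 x0; have := mulr_ge0 b0 y0;
  have := mulr_ge0 (mulr_ge0 b0 b0) x0; have := mulr_ge0 (mulr_ge0 b0 b0) y0; nra.
Qed.

End Rate.

Section BigO.
Context (R : realType).

Lemma bigO_inv (f : nat -> R) (l B : R) (N : nat) : 0 <= B ->
  (forall n, (N <= n)%N -> `|f n - l| <= B / n%:R) ->
  (f : nat -> R^o) = cst l +O_\oo (fun n : nat => n%:R^-1 : R^o).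
Proof.
move=> B0 H; apply/eqaddOP; apply/bigO_exP; exists (B + 1); first by rewrite ltr_wpDl.
near=> n; have Nn : (N <= n)%N by near: n; exact: nbhs_infty_ge.
rewrite (le_trans (H n Nn))// normfV ger0_norm ?ler0n// ler_wpM2r ?invr_ge0//.
by rewrite lerDl.
Unshelve. all: by end_near. Qed.

End BigO.


Section TestErrorBounds.
Context (disp : measure_display) (T : measurableType disp) (R : realType).
Variables (P : probability T R) (n0 d0 : nat) (beta0 : 'cV[R]_d0) (sigma : R).
Hypothesis sigma_gt0 : 0 < sigma.
Variables (X : 'M[{RV P >-> R}]_(n0, d0)) (e : 'cV[{RV P >-> R}]_n0).
Variables (x' : 'cV[{RV P >-> R}]_d0) (e' : {RV P >-> R}).
Hypotheses (X_normal : is_normal_design X) (e_normal : is_normal_vector sigma e).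
Hypotheses (x'_normal : is_normal_vector 1 x') (e'_normal : has_normal_law sigma e').

Lemma norm2_sqr : norm2 beta0 ^+ 2 = sqnorm beta0.
Proof.
rewrite /norm2 sqr_sqrtr ?sqnorm_colE//.
by rewrite sumr_ge0// => i _; exact: sqr_ge0.
Qed.

Definition remainder_mean : R :=
  design_cst beta0 * ((n0 * d0)%:R + n0%:R * sigma ^+ 2).

Lemma remainder_mean_ge0 : 0 <= remainder_mean.
Proof. by rewrite mulr_ge0 ?design_cst_ge0// addr_ge0// mulr_ge0// sqr_ge0. Qed.

Let Q w := design_cst beta0 * (sqnorm (sample X w) + sqnorm (sample e w)).

Let Q0 w : 0 <= Q w.
Proof. by rewrite mulr_ge0 ?design_cst_ge0// addr_ge0// sqnorm_ge0. Qed.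

Let mQ (I : finType) (F : I -> set (set T)) (J : {set I}) i j :
  i \in J -> sigma_mx X `<=` F i -> j \in J -> sigma_mx e `<=` F j ->
  measurable_wrt (joined F J) Q.
Proof.
move=> iJ XF jJ eF; apply: measurable_funM => //; apply: measurable_funD.
  by apply: measurable_sqnorm; exact: measurable_joined_sample iJ XF.
by apply: measurable_sqnorm; exact: measurable_joined_sample jJ eF.
Qed.

Let EQ : (\int[P]_w (Q w)%:E <= remainder_mean%:E)%E.
Proof.
have mM m p (M : 'M[{RV P >-> R}]_(m, p)) :
    measurable_fun setT (fun w => (sqnorm (sample M w))%:E).
  apply/measurable_EFinP; apply: measurable_sqnorm => i j.
  by under eq_fun do rewrite mxE; exact: (measurable_funP (M i j)).
rewrite /Q; under eq_integral do rewrite EFinM EFinD.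
rewrite ge0_integralZl//; first last.
- by rewrite lee_fin design_cst_ge0.
- by move=> w _; rewrite adde_ge0// lee_fin sqnorm_ge0.
- exact: emeasurable_funD.
rewrite ge0_integralD//; first last.
- by move=> w _; rewrite lee_fin sqnorm_ge0.
- by move=> w _; rewrite lee_fin sqnorm_ge0.
rewrite (integral_sqnorm_sample ltr01); last first.
  by move=> i j; exact: (design_normal X_normal (i, j)).
rewrite (integral_sqnorm_sample sigma_gt0); last first.
  by move=> i j; rewrite ord1; case: e_normal.
by rewrite expr1n mulr1 muln1 -EFinD -EFinM.
Qed.

Section SequenceI.
Variables (d : nat) (Z : 'M[{RV P >-> R}]_(n0, d - d0)) (z' : 'cV[{RV P >-> R}]_(d - d0)).
Hypotheses (Z_normal : is_normal_design Z) (z'_normal : is_normal_vector 1 z').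
Hypothesis indep : mutually_independent P
  (tnth [tuple sigma_mx X; sigma_mx e; sigma_mx Z; sigma_mx x'; sigma_rv e'; sigma_mx z']).
Hypotheses (n0_ge1 : (1 <= n0)%N) (d_big : (2 * (d0 + 8 * n0) <= d)%N).

Notation F := (tnth [tuple sigma_mx X; sigma_mx e; sigma_mx Z; sigma_mx x'; sigma_rv e'; sigma_mx z']).
Let o (k : nat) (k6 : (k < 6)%N) : 'I_6 := Ordinal k6.

Let cF i : independence_class (F i).
Proof.
by case: i => [[|[|[|[|[|[|//]]]]]] i6]; rewrite (tnth_nth set0)/=;
  first [exact: independence_class_mx | exact: independence_class_rv].
Qed.

Let mF i : F i `<=` measurable. Proof. by case: (cF i). Qed.
Let FI i : setI_closed (F i). Proof. by case: (cF i). Qed.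
Let FT i : F i setT. Proof. by case: (cF i). Qed.

Let pair_indep (i j : 'I_6) (U V : {RV P >-> R}) : i != j ->
  sigma_rv U `<=` F i -> sigma_rv V `<=` F j ->
  independent_classes P (sigma_rv U) (sigma_rv V).
Proof.
move=> ij UF VF; apply: (sub_independent_classes UF VF).
exact: mutually_independent_pair indep ij.
Qed.

Let Jtr := [set i : 'I_6 | (i < 3)%N]%SET.
Let Jte := [set i : 'I_6 | (3 <= i)%N]%SET.
Let Jc := [set i : 'I_6 | (i == 2 :> nat)%N]%SET.
Let JQ := [set i : 'I_6 | (i < 2)%N]%SET.

Let xt (i : 'I_d) : {RV P >-> R} := col_mx x' z' (widen_ord (leq_addB d0 d) i) 0.

Let xt_normal i : has_normal_law 1 (xt i).
Proof.
rewrite /xt; case: (split_ordP (widen_ord (leq_addB d0 d) i)) => j ->.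
  by rewrite col_mxEu; case: x'_normal.
by rewrite col_mxEd; case: z'_normal.
Qed.

Let col_indep (k l : 'I_(d0 + (d - d0))) : k != l ->
  independent_classes P (sigma_rv (col_mx x' z' k 0)) (sigma_rv (col_mx x' z' l 0)).
Proof.
have ux j : sigma_rv (x' j 0) `<=` F (@o 3 isT) := @sub_sigma_mx _ _ _ _ _ _ x' j 0.
have uz j : sigma_rv (z' j 0) `<=` F (@o 5 isT) := @sub_sigma_mx _ _ _ _ _ _ z' j 0.
case: (split_ordP k) => i ->; case: (split_ordP l) => j -> ij;
  rewrite ?col_mxEu ?col_mxEd.
- case: x'_normal => _ ix.
  by apply: (mutually_independent_pair ix); apply: contra_neq ij => ->.
- exact: (@pair_indep (@o 3 isT) (@o 5 isT)).
- exact: (@pair_indep (@o 5 isT) (@o 3 isT)).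
- case: z'_normal => _ iz.
  by apply: (mutually_independent_pair iz); apply: contra_neq ij => ->.
Qed.

Let xt_indep i j : i != j -> independent_classes P (sigma_rv (xt i)) (sigma_rv (xt j)).
Proof.
move=> ij; apply: col_indep; apply: contra_neq ij => E.
by apply: val_inj; exact: (congr1 val E).
Qed.

Let xt_e'_indep i : independent_classes P (sigma_rv (xt i)) (sigma_rv e').
Proof.
rewrite /xt; case: (split_ordP (widen_ord (leq_addB d0 d) i)) => j ->.
  rewrite col_mxEu; apply: (@pair_indep (@o 3 isT) (@o 4 isT)) => //.
  exact: (@sub_sigma_mx _ _ _ _ _ _ x' j 0).
rewrite col_mxEd; apply: (@pair_indep (@o 5 isT) (@o 4 isT)) => //.
exact: (@sub_sigma_mx _ _ _ _ _ _ z' j 0).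
Qed.

Let xt_measurable i : measurable_wrt (joined F Jte) (xt i).
Proof.
rewrite /xt; case: (split_ordP (widen_ord (leq_addB d0 d) i)) => j ->.
  rewrite col_mxEu; apply: (@measurable_joined_rv _ _ _ _ _ _ _ (@o 3 isT)).
    by rewrite inE.
  exact: (@sub_sigma_mx _ _ _ _ _ _ x' j 0).
rewrite col_mxEd; apply: (@measurable_joined_rv _ _ _ _ _ _ _ (@o 5 isT)).
  by rewrite inE.
exact: (@sub_sigma_mx _ _ _ _ _ _ z' j 0).
Qed.

(** The added predictors have true coefficients 0. *)
Let b w : 'cV[R]_d := extend_rows beta0 0 - beta_hat_I beta0 X e Z w.

Let b_measurable : @measurable_mx _ (g_sigma_algebraType (joined F Jtr)) R d 1 b.
Proof.
have sX : @measurable_mx _ (g_sigma_algebraType (joined F Jtr)) R _ _ (sample X).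
  by apply: (@measurable_joined_sample _ _ _ _ _ F Jtr (@o 0 isT)); rewrite ?inE.
have se : @measurable_mx _ (g_sigma_algebraType (joined F Jtr)) R _ _ (sample e).
  by apply: (@measurable_joined_sample _ _ _ _ _ F Jtr (@o 1 isT)); rewrite ?inE.
have sZ : @measurable_mx _ (g_sigma_algebraType (joined F Jtr)) R _ _ (sample Z).
  by apply: (@measurable_joined_sample _ _ _ _ _ F Jtr (@o 2 isT)); rewrite ?inE.
have mh : @measurable_mx _ (g_sigma_algebraType (joined F Jtr)) R _ _ (beta_hat_I beta0 X e Z).
  apply: measurable_ols; last exact: measurable_extend_cols.
  apply: measurable_addmx => //; apply: measurable_mulmx => //.
by apply: measurable_submx => //; exact: measurable_cst_mx.
Qed.

Lemma test_error_I_bound :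
  test_error_I beta0 X e x' e' Z z' \is a fin_num /\
  `|fine (test_error_I beta0 X e x' e' Z z') - (sigma ^+ 2 + norm2 beta0 ^+ 2)| <=
    rate_cst R n0 * remainder_mean / d%:R.
Proof.
have [c [mc c0 Ec bc]] := gaussian_lower_bound_rate n0_ge1 d_big
  (design_normal Z_normal) (design_independent Z_normal).
have d0d : (d0 <= d)%N by lia.
have n0d : (n0 < d)%N by lia.
have mc' : measurable_wrt (joined F Jc) c.
  apply: sub_measurable_wrt mc => A [ij _ ZA]; apply: sub_sigma_algebra.
  exists (@o 2 isT); first by rewrite /= inE.
  exact: (@sub_sigma_mx _ _ _ _ _ _ Z ij.1 ij.2 A ZA).
have HQ : {ae P, forall w, `|sqnorm (b w) - sqnorm beta0| <= c w * Q w}.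
  apply: filterS bc => w bcw.
  have {}bcw : bounded_below (c w) (sample Z w).
    by rewrite (_ : sample Z w = \matrix_(i, j) Z i j w)//; apply/matrixP => i j; rewrite !mxE.
  rewrite (le_trans (ols_extend_cols_bound _ _ _ d0d n0d (c0 w) bcw))//.
  by rewrite ler_wpM2l// min_norm_remainder.
have EE : test_error_I beta0 X e x' e' Z z' =
    (\int[P]_w ((\sum_i xt i w * b w i 0 + e' w) ^+ 2)%:E)%E.
  rewrite /test_error_I unlock; apply: eq_integral => w _; congr (_ ^+ 2)%:E.
  have -> : \sum_i xt i w * b w i 0 =
      dotv (extend_rows (sample x' w) (sample z' w)) (b w).
    rewrite /dotv dotE; apply: eq_bigr => i _; congr (_ * _).
    rewrite [RHS](_ : _ = col_mx (sample x' w) (sample z' w)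
      (widen_ord (leq_addB d0 d) i) 0); last by rewrite mxE.
    rewrite /xt; case: (split_ordP (widen_ord (leq_addB d0 d) i)) => j ->.
      by rewrite !col_mxEu mxE.
    by rewrite !col_mxEd mxE.
  rewrite /b /dotv dotBr [X in _ = X - _ + _](_ : _ = dotv (sample x' w) beta0).
    by rewrite /test_response addrAC.
  by rewrite /dotv tr_extend_rows mul_extend_cols_rows// mulmx0 addr0.
rewrite EE norm2_sqr mulrAC.
apply: (@test_error_core _ _ _ P d sigma (sqnorm beta0) (rate_cst R n0 / d%:R)
  remainder_mean (joined F Jtr) (joined F Jte) (joined F Jc) (joined F JQ) xt e' b c Q) => //.
- exact: joined_measurable.
- exact: joined_measurable.
- exact: joined_measurable.
- exact: joined_measurable.
- by apply: independent_joined => //; apply: disjoint_predicates => i; rewrite -ltnNge.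
- apply: independent_joined => //; apply: disjoint_predicates => i /eqP ->//.
- by apply: (@measurable_joined_rv _ _ _ _ _ _ _ (@o 4 isT)); rewrite ?inE.
- by apply: (@mQ _ F JQ (@o 0 isT) (@o 1 isT)); rewrite ?inE.
- exact: sqnorm_ge0.
- by rewrite divr_ge0 ?rate_cst_ge0.
- exact: remainder_mean_ge0.
Qed.

End SequenceI.

Section SequenceII.
Variables (n : nat) (W : 'M[{RV P >-> R}]_(n - n0, d0)).
Hypothesis W_normal : is_normal_design W.
Hypothesis indep : mutually_independent P
  (tnth [tuple sigma_mx X; sigma_mx e; sigma_mx W; sigma_mx x'; sigma_rv e']).
Hypotheses (d0_ge1 : (1 <= d0)%N) (n_big : (2 * (n0 + 8 * d0) <= n)%N).

Notation F := (tnth [tuple sigma_mx X; sigma_mx e; sigma_mx W; sigma_mx x'; sigma_rv e']).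
Let o (k : nat) (k5 : (k < 5)%N) : 'I_5 := Ordinal k5.

Let cF i : independence_class (F i).
Proof.
by case: i => [[|[|[|[|[|//]]]]] i5]; rewrite (tnth_nth set0)/=;
  first [exact: independence_class_mx | exact: independence_class_rv].
Qed.

Let mF i : F i `<=` measurable. Proof. by case: (cF i). Qed.
Let FI i : setI_closed (F i). Proof. by case: (cF i). Qed.
Let FT i : F i setT. Proof. by case: (cF i). Qed.

Let Jtr := [set i : 'I_5 | (i < 3)%N]%SET.
Let Jte := [set i : 'I_5 | (3 <= i)%N]%SET.
Let Jc := [set i : 'I_5 | (i == 2 :> nat)%N]%SET.
Let JQ := [set i : 'I_5 | (i < 2)%N]%SET.

Let xt (i : 'I_d0) : {RV P >-> R} := x' i 0.

Let b w : 'cV[R]_d0 := beta0 - beta_hat_II beta0 X e W w.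

Let b_measurable : @measurable_mx _ (g_sigma_algebraType (joined F Jtr)) R d0 1 b.
Proof.
have sX : @measurable_mx _ (g_sigma_algebraType (joined F Jtr)) R _ _ (sample X).
  by apply: (@measurable_joined_sample _ _ _ _ _ F Jtr (@o 0 isT)); rewrite ?inE.
have se : @measurable_mx _ (g_sigma_algebraType (joined F Jtr)) R _ _ (sample e).
  by apply: (@measurable_joined_sample _ _ _ _ _ F Jtr (@o 1 isT)); rewrite ?inE.
have sW : @measurable_mx _ (g_sigma_algebraType (joined F Jtr)) R _ _ (sample W).
  by apply: (@measurable_joined_sample _ _ _ _ _ F Jtr (@o 2 isT)); rewrite ?inE.
have mh : @measurable_mx _ (g_sigma_algebraType (joined F Jtr)) R _ _ (beta_hat_II beta0 X e W).
  apply: measurable_ols; last exact: measurable_extend_rows.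
  apply: measurable_extend_rows; last exact: measurable_cst_mx.
  by apply: measurable_addmx => //; apply: measurable_mulmx.
by apply: measurable_submx => //; exact: measurable_cst_mx.
Qed.

Lemma test_error_II_bound :
  test_error_II beta0 X e x' e' W \is a fin_num /\
  `|fine (test_error_II beta0 X e x' e' W) - (sigma ^+ 2 + norm2 beta0 ^+ 2)| <=
    rate_cst R d0 * remainder_mean / n%:R.
Proof.
(* The rows of W^T are the columns of W: its entries are reindexed. *)
pose swap (k l : nat) (ij : 'I_k * 'I_l) : 'I_l * 'I_k := (ij.2, ij.1).
have swapK k l : cancel (@swap k l) (@swap l k) by case.
have [c [mc c0 Ec bc]] := gaussian_lower_bound_rate d0_ge1 n_big
  (fun ij => design_normal W_normal (swap _ _ ij))
  (mutually_independent_reindex (swapK _ _) (design_independent W_normal)).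
have n0n : (n0 <= n)%N by lia.
have d0n : (d0 <= n)%N by lia.
have mc' : measurable_wrt (joined F Jc) c.
  apply: sub_measurable_wrt mc => A [ij _ WA]; apply: sub_sigma_algebra.
  exists (@o 2 isT); first by rewrite /= inE.
  exact: (@sub_sigma_mx _ _ _ _ _ _ W ij.2 ij.1 A WA).
have HQ : {ae P, forall w, `|sqnorm (b w) - sqnorm beta0| <= c w * Q w}.
  apply: filterS bc => w bcw.
  have {}bcw : bounded_below (c w) (sample W w)^T.
    by rewrite (_ : _^T = \matrix_(i, j) W j i w)//; apply/matrixP => i j; rewrite !mxE.
  rewrite (le_trans (ols_extend_rows_bound _ _ _ n0n d0n (c0 w) bcw))//.
  by rewrite ler_wpM2l// least_squares_remainder.
have EE : test_error_II beta0 X e x' e' W =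
    (\int[P]_w ((\sum_i xt i w * b w i 0 + e' w) ^+ 2)%:E)%E.
  rewrite /test_error_II unlock; apply: eq_integral => w _; congr (_ ^+ 2)%:E.
  have -> : \sum_i xt i w * b w i 0 = dotv (sample x' w) (b w).
    by rewrite /dotv dotE; apply: eq_bigr => i _; rewrite [in RHS]mxE.
  by rewrite /b /dotv dotBr /test_response /dotv addrAC.
have x'e' i : independent_classes P (sigma_rv (xt i)) (sigma_rv e').
  apply: (@sub_independent_classes _ _ _ _ (F (@o 3 isT)) _ (F (@o 4 isT))) => //.
    exact: (@sub_sigma_mx _ _ _ _ _ _ x' i 0).
  exact: mutually_independent_pair indep _.
have [x'1 x'i] := x'_normal.
rewrite EE norm2_sqr mulrAC.
apply: (@test_error_core _ _ _ P d0 sigma (sqnorm beta0) (rate_cst R d0 / n%:R)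
  remainder_mean (joined F Jtr) (joined F Jte) (joined F Jc) (joined F JQ) xt e' b c Q) => //.
- exact: joined_measurable.
- exact: joined_measurable.
- exact: joined_measurable.
- exact: joined_measurable.
- by apply: independent_joined => //; apply: disjoint_predicates => i; rewrite -ltnNge.
- apply: independent_joined => //; apply: disjoint_predicates => i /eqP ->//.
- move=> i; apply: (@measurable_joined_rv _ _ _ _ _ _ _ (@o 3 isT)); first by rewrite inE.
  exact: (@sub_sigma_mx _ _ _ _ _ _ x' i 0).
- by apply: (@measurable_joined_rv _ _ _ _ _ _ _ (@o 4 isT)); rewrite ?inE.
- by move=> i j ij; exact: mutually_independent_pair x'i ij.
- by apply: (@mQ _ F JQ (@o 0 isT) (@o 1 isT)); rewrite ?inE.
- exact: sqnorm_ge0.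
- by rewrite divr_ge0 ?rate_cst_ge0.
- exact: remainder_mean_ge0.
Qed.

End SequenceII.
End TestErrorBounds.

Theorem theorem3p3 (disp : measure_display) (T : measurableType disp)
  (R : realType) (P : probability T R)
  (n0 d0 : nat) (n0_ge1 : (1 <= n0)%N) (d0_ge1 : (1 <= d0)%N)
  (beta0 : 'cV[R]_d0) (sigma : R) (sigma_gt0 : 0 < sigma)
  (X : 'M[{RV P >-> R}]_(n0, d0)) (e : 'cV[{RV P >-> R}]_n0)
  (x' : 'cV[{RV P >-> R}]_d0) (e' : {RV P >-> R})
  (X_normal : is_normal_design X)
  (e_normal : is_normal_vector sigma e)
  (x'_normal : is_normal_vector 1 x')
  (e'_normal : has_normal_law sigma e') :
  (forall (Z : forall d : nat, 'M[{RV P >-> R}]_(n0, d - d0))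
          (z' : forall d : nat, 'cV[{RV P >-> R}]_(d - d0)),
    (forall d, is_normal_design (Z d)) ->
    (forall d, is_normal_vector 1 (z' d)) ->
    (forall d, mutually_independent P
       (tnth [tuple sigma_mx X; sigma_mx e; sigma_mx (Z d);
                    sigma_mx x'; sigma_rv e'; sigma_mx (z' d)])) ->
    (\forall d \near \oo,
       test_error_I beta0 X e x' e' (Z d) (z' d) \is a fin_num) /\
    (fun d : nat => fine (test_error_I beta0 X e x' e' (Z d) (z' d)) : R^o) =
      cst (sigma ^+ 2 + norm2 beta0 ^+ 2)
        +O_\oo (fun d : nat => d%:R^-1 : R^o)) /\
  (forall W : forall n : nat, 'M[{RV P >-> R}]_(n - n0, d0),
    (forall n, is_normal_design (W n)) ->
    (forall n, mutually_independent P
       (tnth [tuple sigma_mx X; sigma_mx e; sigma_mx (W n);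
                    sigma_mx x'; sigma_rv e'])) ->
    (\forall n \near \oo,
       test_error_II beta0 X e x' e' (W n) \is a fin_num) /\
    (fun n : nat => fine (test_error_II beta0 X e x' e' (W n)) : R^o) =
      cst (sigma ^+ 2 + norm2 beta0 ^+ 2)
        +O_\oo (fun n : nat => n%:R^-1 : R^o)).
Proof.
have rem0 q : 0 <= rate_cst R q * remainder_mean n0 beta0 sigma.
  by rewrite mulr_ge0 ?rate_cst_ge0 ?remainder_mean_ge0.
split=> [Z z' Z_normal z'_normal indep|W W_normal indep].
  have bound d (d_big : (2 * (d0 + 8 * n0) <= d)%N) :=
    test_error_I_bound beta0 sigma_gt0 X_normal e_normal x'_normal
      e'_normal (Z_normal d) (z'_normal d) (indep d) n0_ge1 d_big.
  split; last by apply: bigO_inv (rem0 n0) _ => d /bound[].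
  by near=> d; have /bound[] : (2 * (d0 + 8 * n0) <= d)%N by near: d; exact: nbhs_infty_ge.
have bound n (n_big : (2 * (n0 + 8 * d0) <= n)%N) :=
  test_error_II_bound beta0 sigma_gt0 X_normal e_normal x'_normal
    e'_normal (W_normal n) (indep n) d0_ge1 n_big.
split; last by apply: bigO_inv (rem0 d0) _ => n /bound[].
by near=> n; have /bound[] : (2 * (n0 + 8 * d0) <= n)%N by near: n; exact: nbhs_infty_ge.
Unshelve. all: by end_near. Qed.
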